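(* Let $(X,d,\mu)$ be a complete unbounded metric space with $\mu$ Ahlfors $Q$-regular, $Q>1$. Let $1<p<Q/(2-Q)$ if $1<Q<2$, and $p>Q/2$ if $Q\ge 2$. Suppose that $(X,d,\mu)$ supports a $q$-Poincaré inequality, where $q=p$ if $Q/2<p\le Q$ and $q=pQ/(2p-Q)$ if $p\ge Q$. Let $(\hat X,\hat d)$ be the sphericalization of $(X,d)$ with respect to a base point $a\in X$, equipped with the measure $\hat\mu(A)=\int_{A\setminus\{\infty\}}(1+d(x,a))^{-2p}\,d\mu(x)$, and let $\Omega\subset X$ be a nonempty open set. A function $u:\Omega\to\mathbf R$ is a minimizer (resp. superminimizer) in $\Omega$ with respect to $(d,\mu)$ if and only if it is a minimizer (resp. superminimizer) in $\Omega$ with respect to $(\hat d,\hat\mu)$. Similarly, a function on $\Omega$ is $p$-harmonic (resp. superharmonic) with respect to $(d,\mu)$ if and only if it is $p$-harmonic (resp. superharmonic) with respect to $(\hat d,\hat\mu)$.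
   Context: $\mu$ is a positive complete Borel measure with $0<\mu(B)<\infty$ for all balls $B=B(x,r)=\{y:d(x,y)<r\}$; $\lambda B=B(x,\lambda r)$. Ahlfors $Q$-regular: there is $C\ge1$ with $C^{-1}r^Q\le\mu(B(x,r))\le Cr^Q$ for all $x\in X$, $r>0$. Curves are nonconstant, compact and rectifiable, parameterized by arc length $ds$. The $p$-modulus of a curve family $\Gamma$ is $\mathrm{Mod}_p(\Gamma)=\inf\int_X\rho^p\,d\mu$ over Borel $\rho\ge0$ with $\int_\gamma\rho\,ds\ge1$ for all $\gamma\in\Gamma$. A Borel function $g:X\to[0,\infty]$ is an upper gradient of $u:X\to[-\infty,\infty]$ if for all curves $\gamma:[0,l_\gamma]\to X$, $|u(\gamma(0))-u(\gamma(l_\gamma))|\le\int_\gamma g\,ds$ (left-hand side is $\infty$ if a term is infinite). If $g$ is measurable and this holds for all curves outside a family of zero $p$-modulus, $g$ is a $p$-weak upper gradient. If $u$ has an upper gradient in $L^p_{\rm loc}$, it has an a.e. unique minimal $p$-weak upper gradient $g_u$. $X$ supports a $q$-Poincaré inequality if there are $C>0$, $\lambda\ge1$ such that for all balls $B$, all integrable $u$ and all upper gradients $g$ of $u$, $\frac1{\mu(B)}\int_B|u-u_B|\,d\mu\le C\,\mathrm{diam}(B)\bigl(\frac1{\mu(\lambda B)}\int_{\lambda B}g^q\,d\mu\bigr)^{1/q}$, $u_B=\frac1{\mu(B)}\int_Bu\,d\mu$. $\|u\|_{N^{1,p}(X)}^p=\int_X|u|^p\,d\mu+\inf_g\int_Xg^p\,d\mu$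 (infimum over upper gradients $g$ of $u$), and $N^{1,p}(X)$ is the set of everywhere defined measurable $u:X\to[-\infty,\infty]$ with finite norm; $N^{1,p}(E)$ is defined by regarding $E$ as a metric space of its own; $u\in N^{1,p}_{\rm loc}(E)$ if every $x\in E$ has a ball $B_x\ni x$ with $u\in N^{1,p}(B_x\cap E)$. $u\in N^{1,p}_{\rm loc}(\Omega)$ is a superminimizer (resp. minimizer) in $\Omega$ with respect to $(d,\mu)$ if $\int_{\varphi\ne0}g_u^p\,d\mu\le\int_{\varphi\ne0}g_{u+\varphi}^p\,d\mu$ for all nonnegative (resp. all) Lipschitz $\varphi$ with compact support in $\Omega$; a $p$-harmonic function is a continuous minimizer. A function $u:\Omega\to(-\infty,\infty]$, not identically $\infty$ in any component of $\Omega$, is superharmonic if $u(x)=\lim_{r\to0}\operatorname{ess\,inf}_{B(x,r)}u$ for all $x\in\Omega$ and $\min\{u,k\}$ is a superminimizer for every $k\in\mathbf Z$. The notions with respect to $(\hat d,\hat\mu)$ are defined analogously, with $(X,d,\mu)$ replaced by $(\hat X,\hat d,\hat\mu)$. Sphericalization: $\hat X=X\cup\{\infty\}$ is the one-point compactification of $X$. Define $d_a(x,y)=\frac{d(x,y)}{(1+d(x,a))(1+d(y,a))}$ for $x,y\in X$, $d_a(x,\infty)=d_a(\infty,x)=\frac1{1+d(x,a)}$ for $x\in X$, $d_a(\infty,\infty)=0$, and $\hat d(x,y)=\inf\sum_{j=1}^kd_a(x_j,x_{j-1})$, infimum over all finite sequences $x=x_0,x_1,\dots,x_k=y$ in $\hat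 X$. Then $\hat d$ is a metric on $\hat X$, and $(\hat X,\hat d)$ is the sphericalization of $(X,d)$. *)

(* Defs.v *)
From HB Require Import structures.
From mathcomp Require Import all_boot all_order all_algebra.
From mathcomp Require Import all_classical all_reals all_analysis measurable_realfun.
From mathcomp Require Import ring lra.

Set Implicit Arguments.
Unset Strict Implicit.
Unset Printing Implicit Defensive.

Import Order.TTheory GRing.Theory Num.Theory.
Import numFieldNormedType.Exports.

Local Open Scope classical_set_scope.
Local Open Scope ring_scope.

HB.mixin Record isBorelMetric (d : measure_display) (R : numDomainType) T
    & Metric R T & Measurable d T := {
  borel_open_measurable : forall U : set T, open U -> measurable U
}.

(* A metric space with a sigma-algebra containing, possibly strictly, the Borel
   sets: a Borel measure which is complete lives on such a sigma-algebra. *)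
#[short(type="borelMetricType")]
HB.structure Definition BorelMetric (d : measure_display) (R : numDomainType) :=
  { T of Metric R T & Measurable d T & isBorelMetric d R T }.

Section metric_space.
Context (R : realType) (T : metricType R).

Definition complete_space :=
  forall F : set_system T, ProperFilter F -> cauchy F ->
    exists x : T, F --> x.

Definition unbounded_space := forall M : R, exists x y : T, M < mdist x y.

Definition diam (A : set T) : \bar R :=
  ereal_sup [set (mdist x y)%:E | x in A & y in A].

Definition path_length (f : R -> T) (a b : R) : \bar R :=
  ereal_sup [set (\sum_(0 <= i < size s)
      mdist (f (nth b (a :: s) i)) (f (nth b (a :: s) i.+1)))%:E
    | s in itv_partition a b].

(* A nonconstant compact rectifiable curve parameterized by arc length, on
   [0, clen]; the values of cpath outside this interval are irrelevant. *)
Record curve := Curve {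
  clen : R ;
  cpath :> R -> T ;
  clen_gt0 : 0 < clen ;
  curve_arc_length : forall s t, 0 <= s -> s <= t -> t <= clen ->
    path_length cpath s t = (t - s)%:E
}.

Definition curves_in (E : set T) : set curve :=
  [set c | forall t, 0 <= t <= clen c -> E (c t)].

Definition line_integral (g : T -> \bar R) (c : curve) : \bar R :=
  (\int[lebesgue_measure]_(t in `[0%R, clen c]) g (c t))%E.

(* In the difference below, the conventions of \bar R make the left-hand side
   equal to +oo as soon as one of the two terms is infinite. *)
Definition upper_gradient_along (u g : T -> \bar R) (c : curve) :=
  (`|u (c 0%R) - u (c (clen c))| <= line_integral g c)%E.

Definition test_function (E : set T) (phi : T -> R) :=
  [/\ exists L : R, forall x y, `|phi x - phi y| <= L * mdist x y,
      compact (closure [set x | phi x != 0]) &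
      closure [set x | phi x != 0] `<=` E].

End metric_space.

Arguments complete_space {R} T.
Arguments unbounded_space {R} T.

(* Below, a (Borel, in practice open) subset E is regarded as a metric measure
   space of its own: only curves in E and the restriction of mu to E are used.
   Functions on E are represented by total functions whose values outside E
   are irrelevant. *)
Section potential_theory.
Context (R : realType) (d : measure_display) (T : borelMetricType d R).
Variable mu : {measure set T -> \bar R}.
Implicit Types (p q Q : R) (E B : set T) (u g rho : T -> \bar R).
Local Open Scope ereal_scope.

Definition finite_pos_on_balls :=
  forall (x : T) (r : R), (0 < r)%R -> 0 < mu (ball x r) < +oo.

Definition ahlfors_regular Q :=
  exists2 C : R, (1 <= C)%R & forall (x : T) (r : R), (0 < r)%R ->
    (C^-1 * r `^ Q)%:E <= mu (ball x r) <= (C * r `^ Q)%:E.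

Local Notation borelT := (g_sigma_algebraType (@open T)).

Definition borel_fun E g :=
  measurable_fun (E : set borelT) (g : borelT -> \bar R).

Definition modulus p E (G : set (curve T)) : \bar R :=
  ereal_inf [set \int[mu]_(x in E) (rho x `^ p) | rho in
    [set rho | [/\ borel_fun E rho, forall x, E x -> 0 <= rho x &
                   forall c, G c -> 1 <= line_integral rho c]]].

Definition upper_gradient E u g :=
  [/\ borel_fun E g, forall x, E x -> 0 <= g x &
      forall c, curves_in E c -> upper_gradient_along u g c].

Definition weak_upper_gradient p E u g :=
  [/\ measurable_fun E g, forall x, E x -> 0 <= g x &
      exists G : set (curve T), [/\ G `<=` curves_in E, modulus p E G = 0 &
        forall c, curves_in E c -> ~ G c -> upper_gradient_along u g c]].

Definition Lp_loc p E g :=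
  measurable_fun E g /\
  forall x, E x -> exists (y : T) (r : R),
    ball y r x /\ \int[mu]_(z in ball y r `&` E) (`|g z| `^ p) < +oo.

Definition is_minimal_weak_upper_gradient p E u g :=
  [/\ Lp_loc p E g, weak_upper_gradient p E u g &
      forall h, Lp_loc p E h -> weak_upper_gradient p E u h ->
        {ae mu, forall x, E x -> g x <= h x}].

(* g_u, which is determined up to a null set; the default value +oo is only
   taken if u has no minimal p-weak upper gradient. *)
Definition minimal_weak_upper_gradient p E u : T -> \bar R :=
  xget (cst +oo) [set g | is_minimal_weak_upper_gradient p E u g].

(* The p-th power of the norm of N^{1,p}(E). *)
Definition newtonian_norm_pow p E u : \bar R :=
  \int[mu]_(x in E) (`|u x| `^ p) +
  ereal_inf [set \int[mu]_(x in E) (g x `^ p) | g in upper_gradient E u].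

Definition newtonian p E u :=
  measurable_fun E u /\ newtonian_norm_pow p E u < +oo.

Definition newtonian_loc p E u :=
  forall x, E x -> exists (y : T) (r : R),
    ball y r x /\ newtonian p (ball y r `&` E) u.

Definition mean B u : \bar R :=
  ((fine (mu B))^-1)%:E * \int[mu]_(x in B) u x.

Definition poincare_inequality q :=
  exists C lambda : R, [/\ (0 < C)%R, (1 <= lambda)%R &
    forall (x : T) (r : R) u g, (0 < r)%R ->
      mu.-integrable [set: T] u -> upper_gradient [set: T] u g ->
      mean (ball x r) (fun y => `|u y - mean (ball x r) u|) <=
        C%:E * diam (ball x r) *
          mean (ball x (lambda * r)) (fun y => g y `^ q) `^ q^-1].

Definition energy_le p E u (phi : T -> R) :=
  \int[mu]_(x in [set x | phi x != 0%R])
    (minimal_weak_upper_gradient p E u x `^ p) <=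
  \int[mu]_(x in [set x | phi x != 0%R])
    (minimal_weak_upper_gradient p E (fun y => u y + (phi y)%:E) x `^ p).

Definition minimizer p E u :=
  newtonian_loc p E u /\ forall phi, test_function E phi -> energy_le p E u phi.

Definition superminimizer p E u :=
  newtonian_loc p E u /\
  forall phi, test_function E phi -> (forall x, (0 <= phi x)%R) ->
    energy_le p E u phi.

Definition pharmonic p E u := {within E, continuous u} /\ minimizer p E u.

Definition ess_inf_on B u : \bar R :=
  ereal_sup [set y | {ae mu, forall x, B x -> y <= u x}].

Definition superharmonic p E u :=
  [/\ forall x, E x -> -oo < u x,
      forall x, E x -> exists2 y, connected_component E x y & u y != +oo,
      forall x, E x -> ess_inf_on (ball x r) u @[r --> 0^'+] --> u x &
      forall k : int, superminimizer p E (fun x => mine (u x) (k%:~R)%:E)].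

End potential_theory.

(* None is the point at infinity. The parameter a is only there to determine
   the metric below. *)
Definition sphericalization (R : realType) (d : measure_display)
  (X : borelMetricType d R) (a : X) : Type := option X.

Section sphericalization.
Context (R : realType) (d : measure_display) (X : borelMetricType d R) (a : X).
Local Notation sphericalization := (sphericalization a).

HB.instance Definition _ := Choice.on sphericalization.
HB.instance Definition _ := isPointed.Build sphericalization None.

Definition sph_predist (x y : sphericalization) : R :=
  match x, y with
  | Some x, Some y => mdist x y / ((1 + mdist x a) * (1 + mdist y a))
  | Some x, None | None, Some x => (1 + mdist x a)^-1
  | None, None => 0
  end.

(* The sum of d_a over the consecutive pairs of the sequence x :: s. *)
Definition chain_length (x : sphericalization) (s : seq sphericalization) : R :=
  \sum_(t <- pairmap sph_predist x s) t.

Definition chains (x y : sphericalization) : set R :=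
  [set chain_length x s | s in [set s | last x s = y]].

Definition sph_dist (x y : sphericalization) : R := inf (chains x y).

Let w (x : X) : R := 1 + mdist x a.

Let w_ge1 x : 1 <= w x. Proof. by rewrite lerDl mdist_ge0. Qed.

Let w_gt0 x : 0 < w x. Proof. exact: lt_le_trans ltr01 (w_ge1 x). Qed.

Let sph_predist_ge0 x y : 0 <= sph_predist x y.
Proof.
case: x y => [x|] [y|] //=; rewrite ?invr_ge0 ?(ltW (w_gt0 _))//.
by rewrite divr_ge0 ?mdist_ge0// mulr_ge0// ltW// w_gt0.
Qed.

Let sph_predist_sym x y : sph_predist x y = sph_predist y x.
Proof.
by case: x y => [x|] [y|] //=; rewrite metric_sym [X in _ / X]mulrC.
Qed.

Let chain_cons x z s : chain_length x (z :: s) = sph_predist x z + chain_length z s.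
Proof. by rewrite /chain_length/= big_cons. Qed.

Let chain_nil x : chain_length x [::] = 0.
Proof. by rewrite /chain_length/= big_nil. Qed.

Let chain_ge0 x s : 0 <= chain_length x s.
Proof.
elim: s x => [|z s IH] x; first by rewrite chain_nil.
by rewrite chain_cons addr_ge0.
Qed.

Let chain_cat x s t :
  chain_length x (s ++ t) = chain_length x s + chain_length (last x s) t.
Proof. by rewrite /chain_length pairmap_cat big_cat. Qed.

Let chain_rev x s : exists2 t, last (last x s) t = x &
  chain_length (last x s) t = chain_length x s.
Proof.
elim: s x => [|z s IH] x /=; first by exists [::].
have [t tz tE] := IH z; exists (t ++ [:: x]); first by rewrite last_cat.
by rewrite chain_cat tE tz !chain_cons chain_nil addr0 addrC sph_predist_sym.
Qed.

Let chains_nonempty x y : chains x y !=set0.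
Proof. by exists (chain_length x [:: y]); exists [:: y]. Qed.

Let chains_lb x y : lbound (chains x y) 0.
Proof. by move=> _ [s _ <-]. Qed.

Let sph_dist_le x s : sph_dist x (last x s) <= chain_length x s.
Proof. by apply: ge_inf; [exists 0; exact: chains_lb|exists s]. Qed.

Let le_sph_dist x y c :
  (forall s, last x s = y -> c <= chain_length x s) -> c <= sph_dist x y.
Proof.
move=> H; apply: lb_le_inf; first exact: chains_nonempty.
by move=> _ [s /H + <-].
Qed.

Let sph_distxx x : sph_dist x x = 0.
Proof.
apply/eqP; rewrite eq_le le_sph_dist ?andbT//.
by have := sph_dist_le x [::]; rewrite chain_nil.
Qed.

Let sph_dist_sym x y : sph_dist x y = sph_dist y x.
Proof.
wlog suff H : x y / sph_dist x y <= sph_dist y x.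
  by apply/eqP; rewrite eq_le !H.
apply: le_sph_dist => s <-; have [t tx <-] := chain_rev y s.
by rewrite -[X in sph_dist _ X]tx; exact: sph_dist_le.
Qed.

Let sph_dist_triangle y x z : sph_dist x z <= sph_dist x y + sph_dist y z.
Proof.
rewrite -lerBlDr; apply: le_sph_dist => s sy.
rewrite lerBlDr -lerBlDl; apply: le_sph_dist => t tz.
rewrite lerBlDl -tz -sy -chain_cat -last_cat; exact: sph_dist_le.
Qed.

Let h (x : sphericalization) : R := if x is Some x then (w x)^-1 else 0.

Let h_lip x y : h x - h y <= sph_predist x y.
Proof.
case: x y => [x|] [y|] //=; rewrite ?subr0 ?sub0r//; last first.
  by rewrite (@le_trans _ _ 0)// ?oppr_le0 invr_ge0 ltW// w_gt0.
rewrite -/(w x) -/(w y); have [wx wy] := (w_gt0 x, w_gt0 y).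
have -> : (w x)^-1 - (w y)^-1 = (w y - w x) / (w x * w y).
  by field; rewrite !gt_eqF.
rewrite ler_pM2r ?invr_gt0 ?mulr_gt0// /w.
have := metric_triangle y x a; rewrite (metric_sym y x).
by move=> ?; lra.
Qed.

Let chain_lb (c : R) (y : X) s (x : X) : 0 < c -> c <= h (Some x) ->
  last (Some x) s = Some y ->
  (h (Some x) - c <= chain_length (Some x) s) \/
  (mdist x y * c ^+ 2 <= chain_length (Some x) s).
Proof.
move=> c0; elim: s x => [|z s IH] x cx.
  by case=> ->; right; rewrite mdistxx mul0r chain_nil.
rewrite chain_cons => zy; have [zc|cz] := ltP (h z) c.
  by left; have := h_lip (Some x) z; have := chain_ge0 z s; lra.
case: z zy cz => [z|] zy cz; last by move: cz; rewrite leNgt c0.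
have [?|H] := IH z cz zy; [left|right].
  by have := h_lip (Some x) (Some z); lra.
apply: (@le_trans _ _ (mdist x z * c ^+ 2 + mdist z y * c ^+ 2)).
  by rewrite -mulrDl ler_wpM2r ?sqr_ge0// metric_triangle.
rewrite lerD//= -/(w x) -/(w z) ler_wpM2l ?mdist_ge0// invfM expr2.
by rewrite ler_pM ?(ltW c0).
Qed.

Let sph_dist_positivity x y : sph_dist x y = 0 -> x = y.
Proof.
move=> xy0.
have h_le u v : h u - h v <= sph_dist u v.
  apply: le_sph_dist => s <-; elim: s u => [|z s IH] u /=.
    by rewrite subrr chain_nil.
  by rewrite chain_cons; have := h_lip u z; have := IH z; lra.
have hxy : h x = h y.
  apply/eqP; rewrite eq_le -subr_le0 -xy0 h_le/= -subr_le0.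
  by rewrite -xy0 sph_dist_sym h_le.
have hS z : 0 < h (Some z) by rewrite /= invr_gt0.
case: x y hxy xy0 => [x|] [y|] hxy xy0 //.
- congr Some; apply: (@mdist_positivity R); apply/eqP; rewrite eq_le mdist_ge0 andbT.
  rewrite leNgt; apply/negP => dxy.
  pose c := h (Some x) / 2.
  have c0 : 0 < c by rewrite divr_gt0.
  have m0 : 0 < Num.min (h (Some x) - c) (mdist x y * c ^+ 2).
    rewrite lt_min mulr_gt0 ?exprn_gt0// andbT.
    by rewrite /c; have := hS x; lra.
  suff : Num.min (h (Some x) - c) (mdist x y * c ^+ 2) <= sph_dist (Some x) (Some y).
    by rewrite xy0 leNgt m0.
  apply: le_sph_dist => s sy; rewrite ge_min; apply/orP.
  apply: chain_lb => //.
  by rewrite /c; have := hS x; lra.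
- by have := hS x; rewrite hxy ltxx.
- by have := hS y; rewrite -hxy ltxx.
Qed.

HB.instance Definition _ := isMetric.Build R sphericalization
  sph_distxx sph_dist_positivity sph_dist_sym sph_dist_triangle.

Definition sph_measurable : set (set sphericalization) :=
  [set A | measurable (Some @^-1` A : set X)].

Let sph_measurable0 : sph_measurable set0.
Proof. by rewrite /sph_measurable/= preimage_set0. Qed.

Let sph_measurableC A : sph_measurable A -> sph_measurable (~` A).
Proof. by move=> mA; exact: measurableC. Qed.

Let sph_measurable_bigcup (F : (set sphericalization)^nat) :
  (forall i, sph_measurable (F i)) -> sph_measurable (\bigcup_i F i).
Proof.
move=> mF; rewrite /sph_measurable/= preimage_bigcup.
by apply: bigcup_measurable => k _; exact: mF.
Qed.

HB.instance Definition _ := isMeasurable.Build d sphericalization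
  sph_measurable0 sph_measurableC sph_measurable_bigcup.

Let sph_open_measurable (U : set sphericalization) : open U -> measurable U.
Proof.
move=> oU; apply: borel_open_measurable; rewrite openE => x /= Ux.
have : nbhs (Some x : sphericalization) U by exact: open_nbhs_nbhs.
move=> /nbhs_ballP[e /= e0 eU]; apply/nbhs_ballP; exists e => //= y.
rewrite !ballEmdist/= => xy; apply: eU; rewrite ballEmdist/=.
apply: le_lt_trans xy.
have := sph_dist_le (Some x) [:: Some y]; rewrite chain_cons chain_nil addr0/=.
move=> /le_trans; apply.
rewrite ler_pdivrMr ?mulr_gt0 ?w_gt0// ler_peMr ?mdist_ge0//.
by rewrite -[leLHS]mulr1 ler_pM ?w_ge1.
Qed.

HB.instance Definition _ := isBorelMetric.Build d R sphericalization
  sph_open_measurable.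

Section sph_measure.
Variables (p : R) (mu : {measure set X -> \bar R}).
Local Open Scope ereal_scope.

Definition sph_measure (A : set sphericalization) : \bar R :=
  \int[mu]_(x in Some @^-1` A) ((1 + mdist x a) `^ (- (2 * p)))%:E.

Let measurable_weight :
  measurable_fun [set: X] (fun x => ((1 + mdist x a) `^ (- (2 * p)))%:E).
Proof.
apply/measurable_EFinP.
apply: (measurableT_comp (measurable_powR _)); apply: measurable_funD => //.
move=> _; apply: (measurability _ (RGenInftyO.measurableE R)) => //.
move=> _ [_ [r ->] <-]; rewrite setTI; apply: borel_open_measurable.
rewrite openE => x; rewrite /= in_itv/= => xr.
apply/nbhs_ballP; exists (r - mdist x a)%R; first by rewrite /= subr_gt0.
move=> y; rewrite ballEmdist/= in_itv/= => xy.
have := metric_triangle y x a; rewrite (metric_sym y x) => ?.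
by move: xy; lra.
Qed.

Let sph_measure0 : sph_measure set0 = 0.
Proof. by rewrite /sph_measure preimage_set0 integral_set0. Qed.

Let sph_measure_ge0 A : 0 <= sph_measure A.
Proof. by apply: integral_ge0 => x _; rewrite lee_fin powR_ge0. Qed.

Let sph_measure_sigma_additive : semi_sigma_additive sph_measure.
Proof.
move=> F mF tF mUF; rewrite /sph_measure preimage_bigcup.
rewrite ge0_integral_bigcup//.
- apply: is_cvg_ereal_nneg_natsum_cond => n _ _.
  by apply: integral_ge0 => x _; rewrite lee_fin powR_ge0.
- exact: measurable_funTS.
- by move=> x _; rewrite lee_fin powR_ge0.
- by move=> i j _ _ [x [Fix Fjx]]; apply: tF => //; exists (Some x).
Qed.

HB.instance Definition _ := isMeasure.Build _ _ _ sph_measure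
  sph_measure0 sph_measure_ge0 sph_measure_sigma_additive.

End sph_measure.

Definition sph_set (E : set X) : set sphericalization := Some @` E.

(* The value at infinity is irrelevant on subsets of X. *)
Definition sph_fun (u : X -> \bar R) (z : sphericalization) : \bar R :=
  if z is Some x then u x else 0%E.

End sphericalization.

Arguments sph_measure {R d X} a p mu A.
Arguments sph_set {R d X} a E.
Arguments sph_fun {R d X} a u z.

(* Main.v *)
(* Sphericalization is a conformal change of metric whose weight is chosen so
   that p-energies are preserved. With h(x) = 1 / (1 + d(x, a)), every x and y in
   X satisfy |dhat(x, y) - h(x)^2 d(x, y)| <= 4 dhat(x, y) d(x, y). Hence the
   dhat-length of a curve of X is the integral of h^2 over its d-arc length, and
   the rectifiable curves of (X, d) and of the sphericalization minus its point at
   infinity correspond by reparametrization, the line integral of g with respect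
   to dhat being that of h^2 g with respect to d. So g is an upper gradient
   for dhat if and only if h^2 g is one for d, while
   g^p dmuhat = g^p h^(2p) dmu = (h^2 g)^p dmu. Moduli, weak upper gradients,
   minimal ones and their energies therefore correspond exactly, and the remaining
   conditions (test functions, local integrability, continuity, essential limits)
   are local and depend only on the topology and on the local comparability of
   the metrics and of the measures. *)

From HB Require Import structures.
From mathcomp Require Import all_boot all_order all_algebra.
From mathcomp Require Import all_classical all_reals all_analysis measurable_realfun.
From mathcomp Require Import ring lra.
Require Import Defs.

Set Implicit Arguments.
Unset Strict Implicit.
Unset Printing Implicit Defensive.

Import Order.TTheory GRing.Theory Num.Theory.
Import numFieldNormedType.Exports.

Local Open Scope classical_set_scope.
Local Open Scope ring_scope.

(** * Change of variables *)

(** A [curve] carries its arc-length parametrization, so corresponding curves have to be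
    constructed: the length of the image curve is shown to be a primitive [phi] of the weight, and
    the image is composed with the inverse of [phi]. The lengths agree exactly, although the metrics
    are compared only up to an error, because on a Lipschitz curve this error is of second order in
    the parameter increment, and a subadditive defect of quadratic size is nonpositive. A weak upper
    gradient is measurable only for the sigma-algebra of mu, so its composition with a curve may
    fail to be Lebesgue measurable. Line integrals are then lower integrals, and the change of
    variables is proved for these. The passage back to X has the weight h^-2, which is unbounded;
    but a curve of the sphericalization that avoids infinity is compact, so 1 + d(., a) is bounded
    along it, and this bound yields all constants. The term |u|^p of the Newtonian norm is not
    preserved, but h is bounded below on balls of X, so that its local finiteness is. *)

Lemma ge0_le_lower_integral (d : measure_display) (T : measurableType d)
    (R : realType) (mu : {measure set T -> \bar R}) (D : set T)
    (f g : T -> \bar R) :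
  (forall x, D x -> (0 <= f x)%E) -> (forall x, D x -> (f x <= g x)%E) ->
  (\int[mu]_(x in D) f x <= \int[mu]_(x in D) g x)%E.
Proof.
move=> f0 fg; rewrite !ge0_integralE//; last first.
  by move=> x Dx; exact: le_trans (f0 x Dx) (fg x Dx).
apply: ereal_sup_le => _ [s /= sf <-]; exists s => // x.
apply: le_trans (sf x) _; rewrite /patch; case: ifPn => //.
by rewrite inE; exact: fg.
Qed.

Section change_of_variables.
Local Open Scope ereal_scope.
Context (d1 d2 : measure_display) (T1 : measurableType d1)
  (T2 : measurableType d2) (R : realType).
Variables (mu : {measure set T1 -> \bar R}) (nu : {measure set T2 -> \bar R}).
Variables (F : T1 -> T2) (k : T1 -> R).
Hypothesis mF : measurable_fun setT F.
Hypothesis mk : measurable_fun setT k.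
Hypothesis k0 : forall x, (0 <= k x)%R.
Hypothesis nuE : forall A, measurable A ->
  nu A = \int[mu]_(x in F @^-1` A) (k x)%:E.

Import HBNNSimple.

Let mpre A : measurable A -> measurable (F @^-1` A).
Proof. by move=> mA; rewrite -[_ @^-1` _]setTI; exact: mF. Qed.

Let nnsfun_change_of_variables D (s : {nnsfun T2 >-> R}) : measurable D ->
  \int[nu]_(y in D) (s y)%:E = \int[mu]_(x in F @^-1` D) ((s (F x))%:E * (k x)%:E).
Proof.
move=> mD; have mFD := mpre mD.
have mI r : measurable_fun (F @^-1` D)
    (fun x => ((r * \1_(s @^-1` [set r]) (F x))%R * k x)%:E).
  apply/measurable_EFinP; apply: measurable_funM.
    apply: measurable_funM => //; apply: measurable_funTS.
    exact: measurableT_comp.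
  exact: measurable_funTS.
have I0 r x : 0 <= ((r * \1_(s @^-1` [set r]) (F x))%R * k x)%:E.
  by rewrite lee_fin mulr_ge0//; exact: nnfun_muleindic_ge0.
transitivity (\sum_(r \in range s)
    \int[mu]_(x in F @^-1` D) ((r * \1_(s @^-1` [set r]) (F x))%R * k x)%:E);
    last first.
  rewrite -ge0_integral_fsum//.
  apply: eq_integral => x _; rewrite fsumEFin//; congr EFin.
  rewrite [in RHS]fimfunE !fsbig_finite//= big_distrl//=.
under eq_integral do rewrite fimfunE -fsumEFin//.
rewrite ge0_integral_fsum//; last 2 first.
- by move=> y; exact/measurable_EFinP/measurable_funM.
- by move=> y x _; rewrite nnfun_muleindic_ge0.
apply: eq_fsbigr => r _; rewrite integralZl_indic_nnsfun// integral_indic//=.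
have [r0|r0] := ltP r 0%R.
  rewrite preimage_nnfun0// set0I measure0 mule0 integral0_eq// => x _.
  by rewrite indic0 mulr0 mul0r.
under eq_integral do rewrite -mulrA EFinM.
rewrite ge0_integralZl//; last 2 first.
- apply/measurable_EFinP; apply: measurable_funM; last exact: measurable_funTS.
  by apply: measurable_funTS; exact: measurableT_comp.
- by move=> x _; rewrite lee_fin mulr_ge0.
congr *%E; rewrite nuE; last exact: measurableI.
rewrite preimage_setI setIC integral_mkcondr; apply: eq_integral => x _.
rewrite patchE indicE.
rewrite -[x \in _]/(F x \in s @^-1` [set r]).
by case: ifPn => _; rewrite ?mul1r ?mul0r.
Qed.

Lemma ge0_change_of_variables D (f : T2 -> \bar R) :
  measurable D -> measurable_fun D f -> (forall y, D y -> 0 <= f y) ->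
  \int[nu]_(y in D) f y = \int[mu]_(x in F @^-1` D) (f (F x) * (k x)%:E).
Proof.
move=> mD mf f0; have mFD := mpre mD.
pose f_ := nnsfun_approx mD mf.
transitivity (limn (fun n => \int[nu]_(x in D) (f_ n x)%:E)).
  rewrite -monotone_convergence//.
  - apply: eq_integral => y /[!inE] yD; apply/esym/cvg_lim => //.
    exact: cvg_nnsfun_approx.
  - by move=> n; exact/measurable_EFinP/measurable_funTS.
  - by move=> n y _; rewrite lee_fin.
  - by move=> y _ m n mn; rewrite lee_fin; exact/lefP/nd_nnsfun_approx.
under [X in limn X]eq_fun do rewrite nnsfun_change_of_variables//.
rewrite -monotone_convergence//.
- apply: eq_integral => x /[!inE] xD; apply/cvg_lim => //.
  by apply: cvgeZr => //; exact: cvg_nnsfun_approx.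
- move=> n; apply: emeasurable_funM; apply/measurable_EFinP/measurable_funTS => //.
  exact: measurableT_comp.
- by move=> n x _; rewrite mule_ge0// lee_fin.
- move=> x _ m n mn; rewrite lee_wpmul2r ?lee_fin//.
  exact/lefP/nd_nnsfun_approx.
Qed.

(** A simple function below [f] pulls back to a measurable function below the integrand on the
    right. For nonmeasurable [f] this gives one inequality only, since a simple function on [T1]
    need not factor through [F]. *)
Lemma ge0_change_of_variables_le D (f : T2 -> \bar R) :
  measurable D -> (forall y, D y -> 0 <= f y) ->
  \int[nu]_(y in D) f y <= \int[mu]_(x in F @^-1` D) (f (F x) * (k x)%:E).
Proof.
move=> mD f0; rewrite [leLHS]ge0_integralE//.
apply: ge_ereal_sup => _ [s /= sf <-].
(* [s] lies below [f] extended by 0 outside [D], hence vanishes there. *)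
have -> : sintegral nu s = \int[nu]_(y in D) (s y)%:E.
  rewrite integral_nnsfun//; congr sintegral; apply/funext => y.
  rewrite /patch; case: ifPn => // yD; apply/eqP; rewrite eq_le fun_ge0 andbT.
  by have := sf y; rewrite /patch (negbTE yD) lee_fin.
rewrite nnsfun_change_of_variables//; apply: ge0_le_lower_integral => x Dx.
  by rewrite mule_ge0// lee_fin.
apply: lee_wpmul2r; first by rewrite lee_fin.
by have := sf (F x); rewrite patchE mem_set.
Qed.

End change_of_variables.

(* The two inequalities follow from each other by exchanging F with its inverse
   G; no measurability of f is assumed, so the integrals are lower integrals. *)
Lemma bijective_change_of_variables (d1 d2 : measure_display)
    (T1 : measurableType d1) (T2 : measurableType d2) (R : realType)
    (mu : {measure set T1 -> \bar R}) (nu : {measure set T2 -> \bar R})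
    (F : T1 -> T2) (G : T2 -> T1) (k : T1 -> R) (D : set T2) (f : T2 -> \bar R) :
  measurable_fun setT F -> measurable_fun setT G ->
  cancel F G -> cancel G F ->
  measurable_fun setT k -> (forall x, 0 < k x) ->
  (forall A, measurable A -> nu A = (\int[mu]_(x in F @^-1` A) (k x)%:E)%E) ->
  measurable D -> (forall y, D y -> (0 <= f y)%E) ->
  (\int[nu]_(y in D) f y = \int[mu]_(x in F @^-1` D) (f (F x) * (k x)%:E))%E.
Proof.
move=> mF mG FG GF mk k0 nuE mD f0.
have k0' x : 0 <= k x by exact: ltW.
apply/eqP; rewrite eq_le ge0_change_of_variables_le//=.
have mV : measurable_fun setT (fun y => (k (G y))^-1).
  apply: (measurable_comp (F := [set x : R | x != 0])) => //.
  - apply: open_measurable; exact: open_neq.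
  - by move=> _ [y _ <-] /=; rewrite gt_eqF.
  - apply: open_continuous_measurable_fun; first exact: open_neq.
    by move=> x; rewrite inE => /inv_continuous.
  - exact: measurableT_comp.
(* With respect to [nu], [mu] has the reciprocal density, so the one-sided inequality applies to [G]
   too. *)
have muE A : measurable A ->
    mu A = (\int[nu]_(y in G @^-1` A) ((k (G y))^-1)%:E)%E.
  move=> mA; rewrite (ge0_change_of_variables mF mk k0' nuE)//.
  - rewrite (_ : F @^-1` _ = A); last by apply/seteqP; split => x /=; rewrite FG.
    rewrite -[LHS]mul1e -integral_cst//; apply: eq_integral => x _.
    by rewrite FG -EFinM mulVf// gt_eqF.
  - by rewrite -[_ @^-1` _]setTI; exact: mG.
  - by apply/measurable_EFinP; exact: measurable_funTS.
  - by move=> y _; rewrite lee_fin invr_ge0.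
apply: le_trans (ge0_change_of_variables_le mG mV _ muE _ _) _.
- by move=> y; rewrite invr_ge0.
- by rewrite -[_ @^-1` _]setTI; exact: mF.
- by move=> x Dx; rewrite mule_ge0 ?lee_fin//; exact: f0.
- rewrite (_ : G @^-1` _ = D); last by apply/seteqP; split => x /=; rewrite GF.
  apply: ge0_le_lower_integral => y Dy.
    by rewrite !mule_ge0 ?lee_fin ?invr_ge0//; apply: f0; rewrite GF.
  by rewrite GF -muleA -EFinM mulfV ?gt_eqF// mule1.
Qed.

(** * Lengths of paths *)

(* Bisecting [s, t] n times divides the quadratic bound by 2 ^ n. *)
Lemma subadditive_quadratic_le0 (R : realType) (F : R -> R -> R) (a b A : R) :
  (forall s r t, a <= s -> s <= r -> r <= t -> t <= b ->
     F s t <= F s r + F r t) ->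
  (forall s t, a <= s -> s <= t -> t <= b -> F s t <= A * (t - s) ^+ 2) ->
  forall s t, a <= s -> s <= t -> t <= b -> F s t <= 0.
Proof.
move=> Fsub FA s t as_ st tb.
have FAn n : forall s t, a <= s -> s <= t -> t <= b ->
    2 ^+ n * F s t <= A * (t - s) ^+ 2.
  elim: n => [|n IH] u v au uv vb; first by rewrite mul1r FA.
  pose r := (u + v) / 2.
  have [ur rv] : u <= r /\ r <= v by rewrite /r; split; lra.
  have H1 := IH u r au ur (le_trans rv vb).
  have H2 := IH r v (le_trans au ur) rv vb.
  have := Fsub u r v au ur rv vb.
  rewrite -(@ler_pM2l _ (2 ^+ n)) ?exprn_gt0// mulrDr => H3.
  have := le_trans H3 (lerD H1 H2).
  rewrite -(@ler_pM2l _ 2)// mulrA -exprS => /le_trans; apply.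
  rewrite le_eqVlt; apply/orP; left; apply/eqP; rewrite /r.
  by field.
rewrite leNgt; apply/negP => F0.
(* If [F s t] were positive, every power of 2 would be at most [x]. *)
pose x := A * (t - s) ^+ 2 / F s t.
have := FAn (Num.bound x) s t as_ st tb.
apply/negP; rewrite -ltNge -ltr_pdivrMr//.
exact: upper_nthrootP.
Qed.

Section path_length.
Context (R : realType) (T : metricType R).
Implicit Types (f : R -> T) (s : seq R) (a b : R).

(** The sums in [path_length], written with [pairmap] instead of indices to allow induction on the
    partition. *)
Definition polygon f a s : R :=
  \sum_(t <- pairmap (fun x y => mdist (f x) (f y)) a s) t.

Lemma polygon_nil f a : polygon f a [::] = 0.
Proof. exact: big_nil. Qed.

Lemma polygon_cons f a x s :
  polygon f a (x :: s) = mdist (f a) (f x) + polygon f x s.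
Proof. exact: big_cons. Qed.

Lemma polygon_cat f a s1 s2 :
  polygon f a (s1 ++ s2) = polygon f a s1 + polygon f (last a s1) s2.
Proof. by rewrite /polygon pairmap_cat big_cat. Qed.

Lemma path_lengthE f a b :
  path_length f a b = ereal_sup [set (polygon f a s)%:E | s in itv_partition a b].
Proof.
rewrite /path_length; congr ereal_sup; apply: eq_imagel => s _; congr EFin.
elim: s a => [|x s IH] a; first by rewrite /= big_geq// polygon_nil.
by rewrite polygon_cons -IH/= big_nat_recl.
Qed.

Lemma polygon_le_path_length f a b s : itv_partition a b s ->
  ((polygon f a s)%:E <= path_length f a b)%E.
Proof. by move=> sab; rewrite path_lengthE; apply: ereal_sup_ubound; exists s. Qed.

Lemma mdist_le_path_length f a b : a <= b ->
  ((mdist (f a) (f b))%:E <= path_length f a b)%E.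
Proof.
rewrite le_eqVlt => /predU1P[->|ab].
  rewrite mdistxx -(polygon_nil f b); apply: polygon_le_path_length.
  by split=> /=.
apply: le_trans (polygon_le_path_length f (itv_partition1 ab)).
by rewrite polygon_cons polygon_nil addr0.
Qed.

Lemma polygon_le f (phi : R -> R) a b s :
  (forall x y, a <= x -> x <= y -> y <= b -> mdist (f x) (f y) <= phi y - phi x) ->
  itv_partition a b s -> polygon f a s <= phi b - phi a.
Proof.
elim: s a => [|x s IH] a H; first by move/itv_partition_nil => ->; rewrite polygon_nil subrr.
move=> sab; rewrite polygon_cons.
have xb := itv_partition_le (itv_partition_cons sab).
have ax : a <= x by case: sab => /= /andP[/ltW].
have := IH x _ (itv_partition_cons sab).
have := H a x (lexx _) ax xb.
move=> H1 H2; apply: le_trans (lerD H1 (H2 _)) _; last by lra.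
by move=> u v xu; apply: H; exact: le_trans xu.
Qed.

Lemma path_length_le f (phi : R -> R) a b :
  (forall x y, a <= x -> x <= y -> y <= b -> mdist (f x) (f y) <= phi y - phi x) ->
  (path_length f a b <= (phi b - phi a)%:E)%E.
Proof.
move=> H; rewrite path_lengthE; apply: ge_ereal_sup => _ [s sab <-].
by rewrite lee_fin; exact: polygon_le.
Qed.

Lemma path_length_ge0 f a b : a <= b -> (0 <= path_length f a b)%E.
Proof. by move=> /(mdist_le_path_length f); apply: le_trans; rewrite lee_fin mdist_ge0. Qed.

(** Partitions of the two pieces concatenate. The two suprema are removed one after the other by
    subtraction, which is why the infinite case is split off and the lengths are shown to be
    finite. *)
Lemma path_length_superadditive f a b c : a <= b -> b <= c ->
  (path_length f a b + path_length f b c <= path_length f a c)%E.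
Proof.
move=> ab bc.
have [->|Loo] := eqVneq (path_length f a c) +oo%E; first exact: leey.
have L0 := path_length_ge0 f (le_trans ab bc).
have Lfin : path_length f a c \is a fin_num by rewrite ge0_fin_numE// ltey.
have H s1 : itv_partition a b s1 ->
    ((polygon f a s1)%:E + path_length f b c <= path_length f a c)%E.
  move=> s1ab; rewrite -leeBrDl// [leLHS]path_lengthE.
  apply: ge_ereal_sup => _ [s2 s2bc <-]; rewrite leeBrDl//.
  have [_ /eqP s1b] := s1ab.
  rewrite -EFinD -[in polygon f b s2]s1b -polygon_cat.
  exact/polygon_le_path_length/itv_partition_cat/s2bc.
have bc_fin : path_length f b c \is a fin_num.
  rewrite ge0_fin_numE ?path_length_ge0//; move: Lfin; rewrite ge0_fin_numE//.
  apply: le_lt_trans; move: ab; rewrite le_eqVlt => /predU1P[->//|ab].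
  apply: le_trans (H _ (itv_partition1 ab)); rewrite leeDr// lee_fin.
  by rewrite polygon_cons polygon_nil addr0 mdist_ge0.
rewrite -leeBrDr// [leLHS]path_lengthE; apply: ge_ereal_sup => _ [s1 s1ab <-].
by rewrite leeBrDr// H.
Qed.

(** A strictly increasing change of parameter carries partitions, which are strictly increasing
    sequences, to partitions. *)
Lemma path_length_comp f g (phi : R -> R) a b : {homo phi : s t / s < t} ->
  (forall t, a <= t <= b -> f t = g (phi t)) ->
  (path_length f a b <= path_length g (phi a) (phi b))%E.
Proof.
move=> phi_lt fg; rewrite path_lengthE.
apply: ge_ereal_sup => _ [s sab <-].
have -> : polygon f a s = polygon g (phi a) (map phi s).
  elim: s a sab fg => [|x s IH] a sab fg; first by rewrite !polygon_nil.
  have xb := itv_partition_le (itv_partition_cons sab).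
  have ax : a <= x by case: sab => /= /andP[/ltW].
  rewrite /= !polygon_cons -IH//; last 2 first.
  - exact: itv_partition_cons sab.
  - by move=> t /andP[xt tb]; apply: fg; rewrite tb (le_trans ax).
  by rewrite !fg ?ax ?xb ?lexx ?(le_trans ax).
apply: polygon_le_path_length; case: sab => sa /eqP sb; split.
- by apply: homo_path sa => ? ?; exact: phi_lt.
- by rewrite last_map sb.
Qed.

End path_length.

(** * Primitives of positive weights and images of Lebesgue measure *)

Section image_density.
Local Open Scope ereal_scope.
Context (d1 d2 : measure_display) (T1 : measurableType d1)
  (T2 : measurableType d2) (R : realType).
Variables (mu : {measure set T1 -> \bar R}) (F : T1 -> T2) (k : T1 -> R).
Hypothesis mF : measurable_fun setT F.
Hypothesis mk : measurable_fun setT k.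
Hypothesis k0 : forall x, (0 <= k x)%R.

Definition image_density (A : set T2) : \bar R :=
  \int[mu]_(x in F @^-1` A) (k x)%:E.

Let image_density0 : image_density set0 = 0.
Proof. by rewrite /image_density preimage_set0 integral_set0. Qed.

Let image_density_ge0 A : 0 <= image_density A.
Proof. by apply: integral_ge0 => x _; rewrite lee_fin. Qed.

Let image_density_sigma_additive : semi_sigma_additive image_density.
Proof.
have mpre A : measurable A -> measurable (F @^-1` A).
  by move=> mA; rewrite -[_ @^-1` _]setTI; exact: mF.
move=> A mA tA mUA; rewrite /image_density preimage_bigcup.
rewrite ge0_integral_bigcup//.
- apply: is_cvg_ereal_nneg_natsum_cond => n _ _.
  by apply: integral_ge0 => x _; rewrite lee_fin.
- by move=> i; exact: mpre.
- by apply/measurable_EFinP; exact: measurable_funTS.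
- by move=> x _; rewrite lee_fin.
- by move=> i j _ _ [x [Aix Ajx]]; apply: tA => //; exists (F x).
Qed.

(** Makes the image under [F] of the measure with density [k] available as a measure, so that
    uniqueness of Lebesgue measure can be applied to it. *)
Lemma image_density_measure :
  exists nu : {measure set T2 -> \bar R}, forall A, nu A = image_density A.
Proof.
pose mixin := isMeasure.Build _ _ _ image_density image_density0
  image_density_ge0 image_density_sigma_additive.
pose nu : {measure set T2 -> \bar R} := HB.pack image_density mixin.
by exists nu.
Qed.

End image_density.

Section primitive.
Context (R : realType) (w : R -> R) (m M : R).
Hypothesis m_gt0 : 0 < m.
Hypothesis w_cont : continuous w.
Hypothesis w_bound : forall x, m <= w x <= M.
Notation leb := (@lebesgue_measure R).

Let mw : measurable_fun [set: R] w.
Proof. exact: continuous_measurable_fun. Qed.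

Let w_itg (s t : R) : leb.-integrable `[s, t] (EFin \o w).
Proof.
apply: continuous_compact_integrable; first exact: segment_compact.
exact: continuous_subspaceT.
Qed.

Let I (s t : R) : R := (\int[leb]_(x in `[s, t]) w x)%R.

Let IE s t : (I s t)%:E = (\int[leb]_(x in `[s, t]) (w x)%:E)%E.
Proof. by rewrite fineK//; apply: integrable_fin_num => //; exact: w_itg. Qed.

Let I_add s r t : s <= r -> r <= t -> I s t = I s r + I r t.
Proof.
move=> sr rt; apply/eqP; rewrite addrC -subr_eq; apply/eqP.
rewrite /I Rintegral_itvB ?bnd_simp//.
rewrite Rintegral_itv_obnd_cbnd//; apply: integrableS (w_itg r t) => //.
exact: subset_itv_oc_cc.
Qed.

Let I_bound s t lo hi : s <= t -> (forall x, s <= x <= t -> lo <= w x <= hi) ->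
  lo * (t - s) <= I s t <= hi * (t - s).
Proof.
move=> st H.
have cE c : c * (t - s) = (\int[leb]_(x in `[s, t]) c)%R.
  rewrite Rintegral_cst//= lebesgue_measure_itv/= lte_fin.
  by case: ltgtP st => //= -> _; rewrite subrr mulr0.
have ci c : leb.-integrable `[s, t] (EFin \o (fun=> c)).
  apply: continuous_compact_integrable; first exact: segment_compact.
  by apply: continuous_subspaceT => ?; exact: cvg_cst.
apply/andP; split; rewrite cE; apply: le_Rintegral => //= x;
  by rewrite in_itv/= => /H /andP[].
Qed.

Let phi (t : R) : R := if 0 <= t then I 0 t else - I t 0.

Let phiB s t : s <= t -> phi t - phi s = I s t.
Proof.
move=> st; rewrite /phi; case: (leP 0 s) => s0; case: (leP 0 t) => t0.
- by rewrite (I_add s0 st) addrC addKr.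
- by have := le_lt_trans (le_trans s0 st) t0; rewrite ltxx.
- by rewrite opprK (I_add (ltW s0) t0) addrC.
- by rewrite opprK (I_add st (ltW t0)) addrC addrK.
Qed.

(** [phi] is the primitive of [w] that vanishes at 0, and [psi] its inverse. The lower bound [m] on
    the whole line makes [phi] strictly increasing and onto; the upper bound [M] makes it
    Lipschitz. *)
Lemma exists_primitive_homeo : exists phi psi : R -> R,
  [/\ phi 0 = 0, cancel phi psi, cancel psi phi,
      {homo phi : s t / s < t} & {homo psi : s t / s < t}] /\
  [/\ measurable_fun setT phi, measurable_fun setT psi,
      forall s t lo hi, s <= t -> (forall x, s <= x <= t -> lo <= w x <= hi) ->
        lo * (t - s) <= phi t - phi s <= hi * (t - s) &
      forall A : set R, measurable A ->
        leb A = (\int[leb]_(x in phi @^-1` A) (w x)%:E)%E].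
Proof.
have bnd s t lo hi : s <= t -> (forall x, s <= x <= t -> lo <= w x <= hi) ->
    lo * (t - s) <= phi t - phi s <= hi * (t - s).
  by move=> st; rewrite phiB//; exact: I_bound.
have bmM s t : s <= t -> m * (t - s) <= phi t - phi s <= M * (t - s).
  by move=> st; apply: bnd => // x _; exact: w_bound.
have phi0 : phi 0 = 0.
  rewrite /phi lexx; have /andP[] := I_bound (lexx 0) (fun x _ => w_bound x).
  by rewrite subrr !mulr0 => h1 h2; apply/eqP; rewrite eq_le h1 h2.
have philt : {homo phi : s t / s < t}.
  move=> s t st; have /andP[+ _] := bmM s t (ltW st).
  by rewrite -subr_gt0; apply: lt_le_trans; rewrite mulr_gt0// subr_gt0.
have M_gt0 : 0 < M.
  by have /andP[h1 h2] := w_bound 0; exact: lt_le_trans (le_trans h1 h2).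
have philip s t : `|phi s - phi t| <= M * `|s - t|.
  wlog st : s t / s <= t => [H|].
    by have [/H//|/ltW/H] := leP s t; rewrite distrC (distrC s).
  have /andP[h1 h2] := bmM s t st.
  rewrite distrC ger0_norm; first by rewrite distrC ger0_norm ?subr_ge0.
  by apply: le_trans h1; rewrite mulr_ge0 ?subr_ge0// ltW.
have phic : continuous phi.
  move=> s; apply/cvgrPdist_le => e e0; near=> t.
  apply: le_trans (philip _ _) _; rewrite -ler_pdivlMl//.
  near: t; apply: cvgr_dist_le; first exact: cvg_id.
  by rewrite mulr_gt0 ?invr_gt0.
(* [phi] grows at rate at least [m], so [y] lies between its values at -|y|/m and |y|/m. *)
have surj y : exists x, phi x = y.
  pose b := `|y| / m.
  have b0 : 0 <= b by rewrite divr_ge0// ltW.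
  have mb : m * b = `|y| by rewrite mulrC divfK// gt_eqF.
  have bb : - b <= b by lra.
  have hb : `|y| <= phi b.
    by have /andP[+ _] := bmM 0 b b0; rewrite phi0 !subr0 mb.
  have hNb : phi (- b) <= - `|y|.
    have /andP[+ _] := bmM (- b) 0 ltac:(lra); rewrite phi0 sub0r opprK add0r mb.
    lra.
  have /andP[y1 y2] : - `|y| <= y <= `|y| by rewrite -ler_norml.
  have [|c _ cy] := @IVT R phi (- b) b y bb (continuous_subspaceT phic).
    rewrite ge_min le_max (le_trans hNb y1)/=.
    by rewrite (le_trans y2 hb) orbT.
  by exists c.
have [psi phiK] := choice surj.
have phi_inj : injective phi.
  move=> s t st; case: (ltgtP s t) => // /philt; by rewrite st ltxx.
have psiK : cancel phi psi by move=> x; exact: phi_inj.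
have psilt : {homo psi : s t / s < t}.
  move=> s t st; rewrite ltNge; apply/negP; rewrite le_eqVlt => /predU1P[|/philt].
    by move=> /(congr1 phi); rewrite !phiK => ts; move: st; rewrite ts ltxx.
  by rewrite !phiK => /(lt_trans st); rewrite ltxx.
have mphi : measurable_fun setT phi by exact: continuous_measurable_fun.
have mpsi : measurable_fun setT psi.
  apply: nondecreasing_measurable => //; apply: ltW_homo; exact: psilt.
exists phi, psi; split => //; split => // A mA.
have w0 x : 0 <= w x by have /andP[/(lt_le_trans m_gt0)/ltW] := w_bound x.
(* The image of w dx under [phi] is Lebesgue measure because the two agree on half-open intervals:
   the preimage of such an interval is again one, with endpoints moved by [psi]. *)
have [nu nuE] := @image_density_measure _ _ (measurableTypeR R)
  (measurableTypeR R) R leb phi w mphi mw w0.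
have := nuE A; rewrite /image_density => <-.
apply: (@lebesgue_measure_unique R nu _ A mA) => _ [[a b] _ <-] /=.
rewrite nuE /image_density lebesgue_measure_itv/= lte_fin.
case: ltP => [ab|ba]; last first.
  rewrite set_itv_ge ?bnd_simp -?leNgt// preimage_set0.
  by rewrite integral_set0.
have -> : phi @^-1` `]a, b] = `](psi a), (psi b)]%classic.
  have le_phi s t : (phi s <= t) = (s <= psi t).
    by rewrite -[in RHS](psiK s) (le_mono psilt).
  apply/seteqP; split => x /=; rewrite !in_itv/= !ltNge !le_phi//.
rewrite integral_itv_obnd_cbnd; last by apply/measurable_EFinP; exact: measurable_funTS.
by rewrite -IE -phiB ?phiK ?EFinB// ltW// psilt.
Unshelve. all: by end_near. Qed.

End primitive.

(** * Conformal reparametrization of curves *)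

Lemma le_polygon (R : realType) (T1 T2 : metricType R) (f1 : R -> T1)
    (f2 : R -> T2) (q a b : R) (s : seq R) :
  (forall x y, a <= x -> x <= y -> y <= b ->
     q * mdist (f1 x) (f1 y) <= mdist (f2 x) (f2 y)) ->
  itv_partition a b s -> q * polygon f1 a s <= polygon f2 a s.
Proof.
elim: s a => [|x s IH] a H sab; first by rewrite !polygon_nil mulr0.
have xb := itv_partition_le (itv_partition_cons sab).
have ax : a <= x by case: sab => /= /andP[/ltW].
rewrite !polygon_cons mulrDr lerD ?H//.
apply: IH (itv_partition_cons sab) => u v xu.
by apply: H; exact: le_trans xu.
Qed.

Lemma curve_lipschitz (R : realType) (T : metricType R) (c : curve T) s t :
  0 <= s -> s <= t -> t <= clen c -> mdist (c s) (c t) <= t - s.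
Proof.
move=> s0 st tl; rewrite -lee_fin -(curve_arc_length s0 st tl).
exact: mdist_le_path_length.
Qed.

Section reparametrization.
Context (R : realType) (T1 T2 : metricType R) (c : curve T1) (f : R -> T2).
Variables (w : R -> R) (m K : R).
Let l := clen c.
Hypothesis m_gt0 : 0 < m.
Hypothesis K_ge0 : 0 <= K.
Hypothesis w_ge : forall t, 0 <= t <= l -> m <= w t.
Hypothesis w_lip : forall s t, 0 <= s -> s <= t -> t <= l ->
  `|w s - w t| <= K * (t - s).
Hypothesis f_dist : forall s t, 0 <= s -> s <= t -> t <= l ->
  `|mdist (f s) (f t) - w s * mdist (c s) (c t)| <=
    K * (t - s) * mdist (c s) (c t).

Section length.
Variable phi : R -> R.
Hypothesis phi_bound : forall s t lo hi, 0 <= s -> s <= t -> t <= l ->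
  (forall x, s <= x <= t -> lo <= w x <= hi) ->
  lo * (t - s) <= phi t - phi s <= hi * (t - s).

Let phi_near s t : 0 <= s -> s <= t -> t <= l ->
  (w s - K * (t - s)) * (t - s) <= phi t - phi s <=
  (w s + K * (t - s)) * (t - s).
Proof.
move=> s0 st tl; apply: phi_bound => // x /andP[sx xt].
have := w_lip s0 sx (le_trans xt tl).
have : K * (x - s) <= K * (t - s) by rewrite ler_wpM2l// lerD2r.
by rewrite ler_norml => h1 /andP[h2 h3]; apply/andP; split; lra.
Qed.

(** The difference of the two sides is subadditive by the triangle inequality. The distance is at
    most (w s + K (t - s)) (t - s) and the increment of [phi] at least (w s - K (t - s)) (t - s),
    hence the quadratic bound with constant 2 K. *)
Lemma mdist_le_primitive s t : 0 <= s -> s <= t -> t <= l ->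
  mdist (f s) (f t) <= phi t - phi s.
Proof.
move=> s0 st tl; rewrite -subr_le0.
apply: (@subadditive_quadratic_le0 _
  (fun s t => mdist (f s) (f t) - (phi t - phi s)) 0 l (2 * K)) => // {s t s0 st tl}.
- move=> s r t s0 sr rt tl; have := metric_triangle (f s) (f r) (f t).
  by move=> ?; lra.
- move=> s t s0 st tl; have /andP[+ _] := phi_near s0 st tl.
  have := f_dist s0 st tl; rewrite ler_norml => /andP[_ h].
  have := curve_lipschitz s0 st tl.
  have : 0 <= w s + K * (t - s).
    rewrite addr_ge0 ?mulr_ge0 ?subr_ge0//.
    by apply: le_trans (ltW m_gt0) (w_ge _); rewrite s0 (le_trans st).
  by move=> /ler_wpM2l/[apply] ? ?; rewrite expr2; lra.
Qed.

(** The upper bound sums [mdist_le_primitive] over a partition. For the lower bound, the defect of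
    the length is subadditive because length is superadditive, and it is again quadratic. *)
Lemma path_length_primitive s t : 0 <= s -> s <= t -> t <= l ->
  path_length f s t = (phi t - phi s)%:E.
Proof.
move: s t; have ub s t : 0 <= s -> s <= t -> t <= l ->
    (path_length f s t <= (phi t - phi s)%:E)%E.
  move=> s0 st tl; apply: path_length_le => x y sx xy yt.
  by apply: mdist_le_primitive; rewrite ?(le_trans s0) ?(le_trans yt).
have fin s t : 0 <= s -> s <= t -> t <= l -> path_length f s t \is a fin_num.
  move=> s0 st tl; rewrite ge0_fin_numE ?path_length_ge0//.
  by apply: le_lt_trans (ub _ _ s0 st tl) _; rewrite ltry.
move=> s t s0 st tl; apply/eqP; rewrite eq_le ub//=.
rewrite -[leRHS]fineK ?fin// lee_fin -subr_le0.
apply: (@subadditive_quadratic_le0 _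
  (fun s t => phi t - phi s - fine (path_length f s t)) 0 l (3 * K))
  => // {s t s0 st tl}.
- move=> s r t s0 sr rt tl.
  have rl := le_trans rt tl; have r0 := le_trans s0 sr; have st := le_trans sr rt.
  have := path_length_superadditive f sr rt.
  rewrite -[X in (X + _)%E]fineK ?fin// -[X in (_ + X)%E]fineK ?fin//.
  by rewrite -[leRHS]fineK ?fin// -EFinD lee_fin => ?; lra.
- move=> s t s0 st tl; have /andP[_ +] := phi_near s0 st tl.
  (* On [s, t] the map [f] expands distances of [c] by at least [q]: K (t - s) is lost in replacing
     the weight at the left endpoint by [w s], and K (t - s) in [f_dist]. Since [c] is parameterized
     by arc length, the length of [f] is at least q (t - s); together with the error of [phi] this
     gives the constant 3 K. *)
  pose q := w s - 2 * K * (t - s).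
  have L0 : 0 <= fine (path_length f s t) by rewrite fine_ge0 ?path_length_ge0.
  suff : q * (t - s) <= fine (path_length f s t).
    by rewrite /q expr2 => ? ?; lra.
  have [q0|q0] := leP q 0.
    by apply: le_trans L0; rewrite mulr_le0_ge0 ?subr_ge0.
  rewrite mulrC -ler_pdivlMr// -lee_fin -(curve_arc_length s0 st tl).
  rewrite path_lengthE; apply: ge_ereal_sup => _ [S Sst <-].
  rewrite lee_fin ler_pdivlMr// mulrC.
  apply: (@le_trans _ _ (polygon f s S)); last first.
    by rewrite -lee_fin fineK ?fin// polygon_le_path_length.
  apply: le_polygon Sst => x y sx xy yt.
  have x0 := le_trans s0 sx; have yl := le_trans yt tl.
  have := f_dist x0 xy yl; rewrite ler_norml => /andP[+ _].
  have := w_lip s0 sx (le_trans xy yl); rewrite ler_norml => /andP[_ h1] h2.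
  have : (q - w x + K * (y - x)) * mdist (c x) (c y) <= 0.
    rewrite mulr_le0_ge0 ?mdist_ge0// /q.
    have : K * (x - s) <= K * (t - s) by rewrite ler_wpM2l//; lra.
    have : K * (y - x) <= K * (t - s) by rewrite ler_wpM2l//; lra.
    lra.
  by move=> ?; lra.
Qed.

End length.

(** The curve is [f] composed with the inverse of a primitive of the weight, and the formula for
    line integrals is the substitution of that primitive. Besides it, only the endpoints and the set
    of values of the curve are recorded. *)
Lemma exists_reparametrization : exists c2 : curve T2,
  [/\ c2 0 = f 0, c2 (clen c2) = f l,
      forall s, 0 <= s <= clen c2 -> exists2 t, 0 <= t <= l & c2 s = f t,
      forall t, 0 <= t <= l -> exists2 s, 0 <= s <= clen c2 & c2 s = f t &
      forall g : T2 -> \bar R, (forall t, 0 <= t <= l -> (0 <= g (f t))%E) ->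
        line_integral g c2 =
        (\int[lebesgue_measure]_(t in `[0%R, l]) (g (f t) * (w t)%:E))%E].
Proof.
have l_gt0 : 0 < l by exact: clen_gt0.
(* The weight is controlled on [0, l] only; clamping extends it to a continuous function with bounds
   on the whole line, as the construction of the primitive requires. *)
pose clamp t : R := Num.max 0 (Num.min t l).
have clamp_in t : 0 <= clamp t <= l.
  by rewrite /clamp le_max lexx/= ge_max ltW//= ge_min lexx orbT.
have clampE t : 0 <= t <= l -> clamp t = t.
  by move=> /andP[t0 tl]; rewrite /clamp (min_idPl tl) (max_idPr t0).
have clamp_lip s t : s <= t -> 0 <= clamp t - clamp s <= t - s.
  have clampP u : [\/ u <= 0 /\ clamp u = 0, 0 <= u <= l /\ clamp u = u |
      l <= u /\ clamp u = l].
    have [u0|u0] := leP u 0.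
      by apply: Or31; rewrite /clamp max_l// ge_min u0.
    have [ul|ul] := leP u l; first by apply: Or32; rewrite clampE ?(ltW u0).
    by apply: Or33; rewrite /clamp min_r ?ltW// max_r// ltW.
  move=> st.
  by case: (clampP s) => -[+ ->]; case: (clampP t) => -[+ ->] => *;
    apply/andP; split; lra.
pose W t := w (clamp t).
have W_lip s t : `|W s - W t| <= K * `|s - t|.
  wlog st : s t / s <= t => [H|].
    by have [/H//|/ltW/H] := leP s t; rewrite distrC (distrC s).
  have /andP[h1 h2] := clamp_lip s t st.
  have /andP[s0 _] := clamp_in s; have /andP[_ tl] := clamp_in t.
  apply: le_trans (w_lip s0 _ tl) _; first by rewrite -subr_ge0.
  by rewrite ler_wpM2l// distrC ger0_norm// subr_ge0.
have W_cont : continuous W.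
  move=> s; apply/cvgrPdist_le => e e0; near=> t.
  apply: le_trans (W_lip _ _) _.
  (* [K] may be 0, and the next step divides by the constant. *)
  apply: (@le_trans _ _ ((K + 1) * `|s - t|)); first by rewrite ler_wpM2r// lerDl.
  rewrite -ler_pdivlMl ?ltr_wpDl//.
  near: t; apply: cvgr_dist_le; first exact: cvg_id.
  by rewrite mulr_gt0 ?invr_gt0// ltr_wpDl.
have W_bound t : m <= W t <= w 0 + K * l.
  rewrite w_ge//=; have /andP[s0 sl] := clamp_in t.
  have := w_lip (lexx 0) s0 sl; rewrite ler_norml subr0 => /andP[h _].
  have : K * clamp t <= K * l by rewrite ler_wpM2l.
  by rewrite /W => ?; lra.
have [phi [psi [[phi0 phiK psiK philt psilt] [mphi mpsi bnd leb]]]] :=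
  exists_primitive_homeo m_gt0 W_cont W_bound.
have le_phi s t : (phi s <= t) = (s <= psi t).
  by rewrite -[in RHS](phiK s) (le_mono psilt).
have ge_phi s t : (t <= phi s) = (psi t <= s).
  by rewrite -[in RHS](phiK s) (le_mono psilt).
have psi0 : psi 0 = 0 by rewrite -phi0 phiK.
have phi_bound s t lo hi : 0 <= s -> s <= t -> t <= l ->
    (forall x, s <= x <= t -> lo <= w x <= hi) ->
    lo * (t - s) <= phi t - phi s <= hi * (t - s).
  move=> s0 st tl H; apply: bnd => // x /andP[sx xt].
  by rewrite /W clampE ?H ?sx// (le_trans s0 sx) (le_trans xt tl).
have phi_in t : (0 <= phi t <= phi l) = (0 <= t <= l).
  by rewrite -{1}phi0 !(le_mono philt).
have len0 : 0 < phi l by rewrite -phi0 philt.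
have arc s t : 0 <= s -> s <= t -> t <= phi l ->
    path_length (f \o psi) s t = (t - s)%:E.
  move=> s0 st tl.
  have in_l x y : s <= x -> x <= y -> y <= t -> [/\ 0 <= psi x, psi x <= psi y & psi y <= l].
    move=> sx xy yt; split; first by rewrite -le_phi phi0 (le_trans s0).
    - by rewrite (le_mono psilt).
    - by rewrite -ge_phi (le_trans yt).
  have [ps0 pst ptl] := in_l s t (lexx _) st (lexx _).
  apply/eqP; rewrite eq_le; apply/andP; split.
    apply: (@path_length_le _ _ _ id) => x y sx xy yt.
    rewrite -[X in _ <= X - _]psiK -[X in _ <= _ - X]psiK.
    by have [] := in_l x y sx xy yt; exact: mdist_le_primitive.
  (* For the lower bound, [f] is seen as [f \o psi] composed with [phi], so its known length is at
     most that of [f \o psi]. *)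
  rewrite -[X in (_ <= path_length _ X _)%E]psiK.
  rewrite -[X in (_ <= path_length _ _ X)%E]psiK.
  apply: le_trans (path_length_comp (f := f) philt _); last first.
    by move=> x _ /=; rewrite phiK.
  by rewrite (path_length_primitive phi_bound)// !psiK.
exists (Curve len0 arc); split => /=.
- by rewrite psi0.
- by rewrite phiK.
- by move=> s sl; exists (psi s) => //; rewrite -phi_in psiK.
- by move=> t tl; exists (phi t); rewrite ?phi_in// phiK.
- move=> g g0; rewrite /line_integral/=.
  rewrite (@bijective_change_of_variables _ _ _ _ _
    (@lebesgue_measure R) (@lebesgue_measure R) phi psi W)//.
  + rewrite (_ : phi @^-1` _ = `[0, l]%classic).
      apply: eq_integral => t; rewrite inE/= in_itv/= => tl.
      by rewrite phiK /W clampE.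
    by apply/seteqP; split => x /=; rewrite !in_itv/= phi_in.
  + exact: continuous_measurable_fun.
  + by move=> x; have /andP[+ _] := W_bound x; exact: lt_le_trans.
  + by move=> s /=; rewrite in_itv/= -[s]psiK phi_in => /g0; rewrite !psiK.
Unshelve. all: by end_near. Qed.

End reparametrization.

(** * The metric of the sphericalization *)

Section spherical_metric.
Context (R : realType) (d : measure_display) (X : borelMetricType d R) (a : X).
Local Notation S := (sphericalization a).
Local Notation emb := (Some : X -> S).
Implicit Types (x y : X) (z : S).

Definition conformal_factor x : R := (1 + mdist x a)^-1.
Local Notation conf := conformal_factor.

(** This is d_a(z, infinity). It is 1-Lipschitz for dhat and measures how far a point stays from
    infinity. *)
Definition sph_conf z : R := if z is Some x then conf x else 0.

Lemma conf_gt0 x : 0 < conf x.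
Proof. by rewrite invr_gt0 ltr_wpDr ?mdist_ge0. Qed.

Lemma conf_le1 x : conf x <= 1.
Proof. by rewrite invf_le1 ?lerDl ?mdist_ge0// ltr_wpDr ?mdist_ge0. Qed.

Lemma sph_predist_embE x y :
  sph_predist (emb x) (emb y) = mdist x y * conf x * conf y.
Proof. by rewrite /sph_predist /conformal_factor invfM mulrA. Qed.

Lemma sph_mdistE z z' : mdist z z' = inf (chains z z').
Proof. by []. Qed.

Lemma sph_predist_ge0 z z' : 0 <= sph_predist z z'.
Proof.
case: z z' => [x|] [y|] //=; rewrite ?divr_ge0 ?invr_ge0 ?mulr_ge0//;
  by rewrite ?addr_ge0 ?mdist_ge0.
Qed.

Lemma chain_length_cons z z' s :
  chain_length z (z' :: s) = sph_predist z z' + chain_length z' s.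
Proof. exact: big_cons. Qed.

Lemma chain_length_nil z : chain_length z [::] = 0.
Proof. exact: big_nil. Qed.

Lemma chain_length_ge0 z s : 0 <= chain_length z s.
Proof.
elim: s z => [|z' s IH] z; first by rewrite chain_length_nil.
by rewrite chain_length_cons addr_ge0// sph_predist_ge0.
Qed.

Lemma sph_mdist_le_predist z z' : mdist z z' <= sph_predist z z'.
Proof.
rewrite sph_mdistE; apply: ge_inf.
  by exists 0 => _ [s _ <-]; exact: chain_length_ge0.
by exists [:: z'] => //; rewrite chain_length_cons chain_length_nil addr0.
Qed.

Lemma le_sph_mdist z z' (c : R) :
  (forall s, last z s = z' -> c <= chain_length z s) -> c <= mdist z z'.
Proof.
move=> H; rewrite sph_mdistE; apply: lb_le_inf.
  by exists (chain_length z [:: z']); exists [:: z'].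
by move=> _ [s /H + <-].
Qed.

Lemma conf_lip x y : conf x - conf y <= mdist x y * conf x * conf y.
Proof.
have hx := conf_gt0 x; have hy := conf_gt0 y.
have -> : conf x - conf y = ((1 + mdist y a) - (1 + mdist x a)) * conf x * conf y.
  by rewrite /conformal_factor; field; rewrite !gt_eqF// ltr_wpDr ?mdist_ge0.
rewrite ler_pM2r// ler_pM2r//.
by have := metric_triangle y x a; rewrite (metric_sym y x) => ?; lra.
Qed.

Lemma sph_conf_le_predist z z' : sph_conf z - sph_conf z' <= sph_predist z z'.
Proof.
case: z z' => [x|] [y|] /=; rewrite ?subr0 ?sub0r//.
- by rewrite -/(sph_predist (emb x) (emb y)) sph_predist_embE conf_lip.
- by rewrite (@le_trans _ _ 0) ?oppr_le0// ?invr_ge0 ?addr_ge0 ?mdist_ge0// ltW// conf_gt0.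
Qed.

Lemma sph_conf_lip z z' : `|sph_conf z - sph_conf z'| <= mdist z z'.
Proof.
have H u v : sph_conf u - sph_conf v <= mdist u v.
  apply: le_sph_mdist => s <-; elim: s u => [|u' s IH] u /=.
    by rewrite subrr chain_length_nil.
  rewrite chain_length_cons; have := sph_conf_le_predist u u'.
  by have := IH u'; lra.
by rewrite ler_norml lerNl opprB H andbT metric_sym H.
Qed.

Lemma sph_mdist_le x y : mdist (emb x) (emb y) <= mdist x y * conf x * conf y.
Proof. by rewrite -sph_predist_embE; exact: sph_mdist_le_predist. Qed.

Lemma sph_mdist_le_mdist x y : mdist (emb x) (emb y) <= mdist x y.
Proof.
apply: le_trans (sph_mdist_le _ _) _.
rewrite -mulrA ler_piMr ?mdist_ge0//.
by rewrite mulr_ile1 ?conf_le1// ltW// conf_gt0.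
Qed.

(** A chain shorter than h(x) cannot pass through infinity, and by [conf_lip] h stays at least h(x)
    minus the length of the chain at all its points. Each step then costs at least the square of
    this number times its d-length, and the triangle inequality sums the steps. *)
Lemma chain_length_lower_bound x y s : last (emb x) s = emb y ->
  chain_length (emb x) s < conf x ->
  mdist x y * (conf x - chain_length (emb x) s) ^+ 2 <= chain_length (emb x) s.
Proof.
elim: s x => [|z s IH] x; first by case=> ->; rewrite mdistxx mul0r chain_length_nil.
rewrite chain_length_cons /=; case: z => [z|] sy; last first.
  by rewrite -/(conf x) gtrDl ltNge chain_length_ge0.
rewrite -/(sph_predist (emb x) (emb z)).
have := conf_lip x z; have := chain_length_ge0 (emb z) s.
have := sph_predist_ge0 (emb x) (emb z).
rewrite sph_predist_embE.
have := IH _ sy; have : mdist x z * conf x * conf z = mdist x z * (conf x * conf z).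
  by rewrite mulrA.
(* From here on [e] is the length of the first step and [r] that of the rest of the chain. *)
move: (mdist x z * conf x * conf z) (chain_length (emb z) s) => e r eE {}IH e0 r0 h1 h2.
have h3 : r < conf z by lra.
have h0 : 0 <= conf x - (e + r) by lra.
have h4 : mdist z y * (conf x - (e + r)) ^+ 2 <= r.
  apply: le_trans (IH h3); rewrite ler_wpM2l ?mdist_ge0//.
  by rewrite ler_sqr ?nnegrE//; lra.
have h5 : mdist x z * (conf x - (e + r)) ^+ 2 <= e.
  by rewrite [leRHS]eE ler_wpM2l ?mdist_ge0// expr2 ler_pM//; lra.
apply: le_trans (lerD h5 h4); rewrite -mulrDl ler_wpM2r ?sqr_ge0//.
exact: metric_triangle.
Qed.

Lemma sph_mdist_lower_bound x y (c : R) : 0 <= c ->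
  mdist (emb x) (emb y) < conf x - c ->
  mdist x y * c ^+ 2 <= mdist (emb x) (emb y).
Proof.
move=> c0 h.
(* The infimum mixes chains that come close to infinity and chains that do not; the minimum bounds
   both kinds. *)
suff : Num.min (conf x - c) (mdist x y * c ^+ 2) <= mdist (emb x) (emb y).
  by rewrite ge_min leNgt h.
apply: le_sph_mdist => s sy; rewrite ge_min; apply/orP.
have [?|H] := leP (conf x - c) (chain_length (emb x) s); [by left|right].
have c1 : c < conf x - chain_length (emb x) s by lra.
apply: le_trans (chain_length_lower_bound sy _); last lra.
by rewrite ler_wpM2l ?mdist_ge0// ler_sqr ?nnegrE; lra.
Qed.

(** Put e = dhat(x, y). The upper bound is the one-step chain with h(y) <= h(x) + e. For the lower
    bound take c = h(x) - 2 e in [sph_mdist_lower_bound]: since h <= 1, c^2 >= h(x)^2 - 4 e, which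
    is the origin of the 4. If c is not positive, h(x)^2 <= h(x) <= 2 e and the bound is trivial. *)
Lemma sph_mdist_conformal x y :
  `|mdist (emb x) (emb y) - conf x ^+ 2 * mdist x y| <=
    4 * mdist (emb x) (emb y) * mdist x y.
Proof.
have d0 := mdist_ge0 x y; have h0 := conf_gt0 x; have h1 := conf_le1 x.
have e0 := mdist_ge0 (emb x) (emb y).
rewrite ler_norml; apply/andP; split; last first.
  have hyx : conf y <= conf x + mdist (emb x) (emb y).
    have := sph_conf_lip (emb y) (emb x); rewrite ler_norml metric_sym /=.
    by move=> /andP[]; lra.
  have : mdist x y * conf x * conf y <= mdist x y * conf x * (conf x + mdist (emb x) (emb y)).
    by rewrite ler_wpM2l// mulr_ge0// ltW.
  have : mdist x y * conf x * mdist (emb x) (emb y) <= mdist x y * 1 * mdist (emb x) (emb y).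
    by rewrite ler_wpM2r// ler_wpM2l.
  have := sph_mdist_le x y; move: (mdist (emb x) (emb y)) e0 {hyx} => e e0.
  have : 0 <= e * mdist x y by rewrite mulr_ge0.
  by rewrite expr2; lra.
suff : mdist x y * (conf x ^+ 2 - 4 * mdist (emb x) (emb y)) <= mdist (emb x) (emb y).
  by move=> ?; lra.
have [->|xy] := eqVneq x y; first by rewrite !mdistxx mul0r.
have {}e0 : 0 < mdist (emb x) (emb y).
  by rewrite mdist_gt0; apply: contra xy => /eqP[->].
move: (@sph_mdist_lower_bound x y); move: (mdist (emb x) (emb y)) e0 => e e0 H.
have [e1|e1] := leP (conf x) (2 * e).
  apply: le_trans (ltW e0); rewrite mulr_ge0_le0//.
  have : conf x * conf x <= 1 * conf x by rewrite ler_wpM2r// ltW.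
  by rewrite expr2; lra.
apply: le_trans (H (conf x - 2 * e) _ _); [|lra|lra].
rewrite ler_wpM2l// !expr2.
have : 0 <= (1 - conf x) * e by rewrite mulr_ge0 ?subr_ge0// ltW.
by have := mulr_ge0 (ltW e0) (ltW e0); lra.
Qed.

End spherical_metric.

(** * Correspondence of curves in X and in its sphericalization *)

Section conformal_curves.
Context (R : realType) (d : measure_display) (X : borelMetricType d R) (a : X).
Local Notation S := (sphericalization a).
Local Notation emb := (Some : X -> S).
Local Notation conf := (conformal_factor a).
Implicit Types (x y : X) (z : S).

Definition sph_pull (g : S -> \bar R) (x : X) : \bar R :=
  (g (emb x) * (conf x ^+ 2)%:E)%E.

Lemma sph_pull_ge0 (g : S -> \bar R) x : (0 <= g (emb x))%E -> (0 <= sph_pull g x)%E.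
Proof. by move=> g0; rewrite mule_ge0// lee_fin sqr_ge0. Qed.

(** Records all that moduli and upper gradients see of a curve, and forgets the parametrizations.
    Nonnegativity of [g] is asked along [c] only, because densities are controlled only on the set
    considered. *)
Definition conformal_curves (c : curve X) (c' : curve S) :=
  [/\ forall E, curves_in E c <-> curves_in (sph_set a E) c',
      c' 0 = emb (c 0), c' (clen c') = emb (c (clen c)) &
      forall g : S -> \bar R,
        (forall t, 0 <= t <= clen c -> (0 <= g (emb (c t)))%E) ->
        line_integral g c' = line_integral (sph_pull g) c].

(** With e = dhat(x, y): if 8 e k^2 <= 1, the error term in [sph_mdist_conformal] is at most half of
    h(x)^2 d(x, y), so d(x, y) <= 2 k^2 e. Otherwise d(x, y) <= 2 k suffices. *)
Lemma mdist_le_sph_mdist x y (k : R) : 1 + mdist x a <= k -> 1 + mdist y a <= k ->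
  mdist x y <= 16 * k ^+ 3 * mdist (emb x) (emb y).
Proof.
move=> xk yk; have := mdist_ge0 x a; have d0 := mdist_ge0 x y.
move=> x0; have k1 : 1 <= k by lra.
have := sph_mdist_conformal a x y; rewrite ler_norml => /andP[+ _].
have : k^-1 ^+ 2 <= conf x ^+ 2.
  have k0 : 0 < k by lra.
  rewrite ler_sqr ?nnegrE ?(ltW (conf_gt0 _ _)) ?invr_ge0 ?(ltW k0)//.
  by rewrite lef_pV2 ?posrE//; lra.
have e0 := mdist_ge0 (emb x) (emb y).
have : mdist x y <= 2 * k.
  have := metric_triangle x a y; rewrite (metric_sym a y).
  by move=> ?; lra.
move: (mdist (emb x) (emb y)) e0 (mdist x y) d0 (conf x ^+ 2) => e e0 D D0 h Dk hk H.
have kk : k ^+ 3 = k * k ^+ 2 by rewrite exprS.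
have k2 : 1 <= k ^+ 2 by rewrite exprn_ege1.
have k3 : k ^+ 2 <= k ^+ 3 by rewrite kk ler_peMl// ltW// exprn_gt0//; lra.
have [h1|h1] := leP (8 * e * k ^+ 2) 1.
  have h2 : D * (h - 4 * e) * (2 * k ^+ 2) <= e * (2 * k ^+ 2).
    by rewrite ler_wpM2r//; lra.
  have h3 : 1 <= h * k ^+ 2.
    have : k^-1 ^+ 2 * k ^+ 2 <= h * k ^+ 2 by rewrite ler_wpM2r//; lra.
    by rewrite -exprMn mulVf ?expr1n//; lra.
  have h4 : D * 1 <= D * ((h - 4 * e) * (2 * k ^+ 2)).
    by rewrite ler_wpM2l//; lra.
  have : e * k ^+ 2 <= e * k ^+ 3 by rewrite ler_wpM2l.
  have : 0 <= e * k ^+ 2 by rewrite mulr_ge0//; lra.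
  lra.
have : 2 * k * 1 <= 2 * k * (8 * e * k ^+ 2) by rewrite ler_wpM2l//; lra.
by rewrite kk; lra.
Qed.

Lemma conformal_image (c : curve X) : exists c' : curve S, conformal_curves c c'.
Proof.
have l0 := clen_gt0 c.
have cl s t : 0 <= s -> s <= t -> t <= clen c -> mdist (c s) (c t) <= t - s.
  exact: curve_lipschitz.
(* The curve stays within distance [clen c] of its starting point, so [n] bounds h from below along
   it. *)
pose n := (1 + mdist (c 0) a + clen c)^-1.
have n0 : 0 < n by rewrite invr_gt0 -addrA ltr_wpDr// addr_ge0 ?mdist_ge0 ?ltW.
have [|||||] := @exists_reparametrization R X S c (emb \o c)
  (fun t => conf (c t) ^+ 2) (n ^+ 2) 4.
- by rewrite exprn_gt0.
- by [].
- move=> t /andP[t0 tl].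
  rewrite ler_sqr ?nnegrE ?(ltW n0) ?(ltW (conf_gt0 _ _))// /n /conformal_factor lef_pV2 ?posrE; last 2 first.
    + by rewrite -invr_gt0.
    + by rewrite ltr_wpDr ?mdist_ge0.
  rewrite -addrA lerD2l; have := cl 0 t (lexx _) t0 tl.
  have := metric_triangle (c t) (c 0) a; rewrite (metric_sym (c t) (c 0)) => ? ?; lra.
- move=> s t s0 st tl.
  rewrite subr_sqr normrM mulrC.
  have := sph_conf_lip (emb (c s)) (emb (c t)).
  move=> /le_trans/(_ (sph_mdist_le_mdist a _ _))/le_trans/(_ (cl s t s0 st tl)) /= h.
  apply: ler_pM => //; rewrite ger0_norm; last by rewrite addr_ge0// ltW// conf_gt0.
  by have := conf_le1 a (c s); have := conf_le1 a (c t); lra.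
- move=> s t s0 st tl; apply: le_trans (sph_mdist_conformal a _ _) _.
  rewrite ler_wpM2r ?mdist_ge0// ler_wpM2l//.
  by apply: le_trans (sph_mdist_le_mdist a _ _) _; exact: cl.
move=> c' [c'0 c'l im1 im2 li]; exists c'; split => //.
move=> E; split=> cE t tl.
  by have [s /cE Es ->] := im1 t tl; exists (c s).
by have [s /cE [x Ex xE] /= c'E] := im2 t tl; move: xE; rewrite c'E => -[<-].
Qed.

(** The same reparametrization with the roles of the metrics exchanged and the weight h^-2. All
    bounds are expressed through the maximum [k] of 1 + d(., a) along the curve. *)
Lemma conformal_preimage (c' : curve S) : curves_in (sph_set a [set: X]) c' ->
  exists c : curve X, conformal_curves c c'.
Proof.
move=> c'X; have l0 := clen_gt0 c'.
have cl s t : 0 <= s -> s <= t -> t <= clen c' -> mdist (c' s) (c' t) <= t - s.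
  exact: curve_lipschitz.
(* The default value [a] is never taken on the parameter interval, where the curve avoids
   infinity. *)
pose f t : X := if c' t is Some x then x else a.
have fE t : 0 <= t <= clen c' -> c' t = emb (f t).
  by move=> /c'X[x _]; rewrite /f => <-.
(* [sph_conf] attains its minimum along the curve, and the minimum is positive because infinity is
   avoided. *)
have [k k0 fk] : exists2 k : R, 0 < k & forall t, 0 <= t <= clen c' -> 1 + mdist (f t) a <= k.
  have [||t0] := @EVT_min R (fun t => sph_conf (c' t)) 0 (clen c').
  - exact: ltW.
  - apply/subspace_continuousP => s /=; rewrite in_itv/= => sl.
    apply/cvgrPdist_le => e e0; near=> t.
    have : 0 <= t <= clen c' by near: t; exact: withinT.
    move=> tl; apply: le_trans (sph_conf_lip _ _) _.
    apply: (@le_trans _ _ `|s - t|).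
      have /andP[s0 sl1] := sl; have /andP[t0 tl1] := tl.
      have [st|/ltW st] := leP s t; first by rewrite distrC ger0_norm ?subr_ge0// cl.
      by rewrite metric_sym ger0_norm ?subr_ge0// cl.
    near: t; apply: cvg_within; apply/nbhs_ballP.
    by exists e => //= t /ltW.
  rewrite in_itv/= => t0l H; exists (1 + mdist (f t0) a).
    by rewrite ltr_wpDr ?mdist_ge0.
  move=> t tl; have := H t; rewrite in_itv/= => /(_ tl).
  by rewrite !fE//= lef_pV2// posrE ltr_wpDr ?mdist_ge0.
pose w t := (1 + mdist (f t) a) ^+ 2.
have Df s t : 0 <= s -> s <= t -> t <= clen c' ->
    mdist (f s) (f t) <= 16 * k ^+ 3 * mdist (c' s) (c' t).
  move=> s0 st tl.
  have sl : 0 <= s <= clen c' by rewrite s0 (le_trans st).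
  have tl' : 0 <= t <= clen c' by rewrite tl (le_trans s0).
  by rewrite (fE s)// (fE t)//; apply: mdist_le_sph_mdist; exact: fk.
have k1 : 1 <= k.
  have := fk 0; rewrite lexx ltW// => /(_ isT); have := mdist_ge0 (f 0) a.
  by move=> ? ?; lra.
(* By [Df], [f] is Lipschitz with constant 16 k^3. Multiplying the conformal error 4 dhat d by the
   weight, at most k^2, gives 64 k^5; the Lipschitz constant of [w], 16 k^3 times 2 k, is below
   this. *)
have [|||||] := @exists_reparametrization R S X c' f w 1 (64 * k ^+ 5).
- by [].
- by rewrite mulr_ge0// exprn_ge0// ltW.
- by move=> t tl; rewrite /w exprn_ege1// lerDl mdist_ge0.
- move=> s t s0 st tl; rewrite /w subr_sqr normrM.
  have sl : 0 <= s <= clen c' by rewrite s0 (le_trans st).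
  have tl' : 0 <= t <= clen c' by rewrite tl (le_trans s0).
  have h1 : `|1 + mdist (f s) a - (1 + mdist (f t) a)| <= 16 * k ^+ 3 * (t - s).
    apply: (@le_trans _ _ (mdist (f s) (f t))).
      have := metric_triangle (f s) (f t) a; have := metric_triangle (f t) (f s) a.
      by rewrite (metric_sym (f t) (f s)) ler_norml => ? ?; apply/andP; split; lra.
    apply: le_trans (Df _ _ s0 st tl) _; rewrite ler_wpM2l ?cl//.
    by rewrite mulr_ge0// exprn_ge0// ltW.
  have h2 : `|1 + mdist (f s) a + (1 + mdist (f t) a)| <= 2 * k.
    rewrite ger0_norm ?addr_ge0 ?mdist_ge0//.
    by have := fk s sl; have := fk t tl'; lra.
  apply: le_trans (ler_pM _ _ h1 h2) _ => //.
  rewrite [leLHS](_ : _ = 32 * k ^+ 4 * (t - s)); last by ring.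
  rewrite ler_wpM2r ?subr_ge0//.
  have : k ^+ 4 <= k ^+ 5 by rewrite [leRHS]exprS ler_peMl// exprn_ge0// ltW.
  have : 0 <= k ^+ 5 by rewrite exprn_ge0// ltW.
  by move=> ? ?; lra.
- move=> s t s0 st tl.
  have sl : 0 <= s <= clen c' by rewrite s0 (le_trans st).
  have tl' : 0 <= t <= clen c' by rewrite tl (le_trans s0).
  have := sph_mdist_conformal a (f s) (f t); rewrite -!fE//.
  have := cl s t s0 st tl; have := Df s t s0 st tl.
  have := mdist_ge0 (c' s) (c' t); have d0 := mdist_ge0 (f s) (f t).
  have wc : w s * conf (f s) ^+ 2 = 1.
    rewrite /w /conformal_factor -exprMn mulfV ?expr1n// gt_eqF//.
    by rewrite ltr_wpDr ?mdist_ge0.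
  have w0 : 0 <= w s by rewrite sqr_ge0.
  have wk : w s <= k ^+ 2.
    by rewrite ler_sqr ?nnegrE ?addr_ge0 ?mdist_ge0 ?(ltW k0)// fk.
  move: (mdist (c' s) (c' t)) => e e0 de est; rewrite distrC => h.
  have -> : mdist (f s) (f t) - w s * e =
      w s * (conf (f s) ^+ 2 * mdist (f s) (f t) - e).
    by rewrite mulrBr mulrA wc mul1r.
  rewrite normrM ger0_norm//.
  apply: le_trans (ler_wpM2l w0 h) _.
  have h1 : w s * (4 * e * mdist (f s) (f t)) <=
      k ^+ 2 * (4 * e * (16 * k ^+ 3 * e)).
    by rewrite ler_pM// ?mulr_ge0// ler_wpM2l// mulr_ge0.
  apply: le_trans h1 _.
  rewrite [leLHS](_ : _ = 64 * k ^+ 5 * e * e); last by ring.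
  by rewrite ler_wpM2r// ler_wpM2l// mulr_ge0// exprn_ge0// ltW.
move=> c [c0 cc im1 im2 li]; exists c; split.
- move=> E; split=> cE t tl.
    by have [s /cE Es ft] := im2 t tl; rewrite fE//; exists (c s); rewrite // ft.
  by have [s sl ->] := im1 t tl; have [x Ex] := cE s sl; rewrite fE// => -[<-].
- by rewrite c0 -fE// lexx ltW.
- by rewrite cc -fE// lexx ltW.
- move=> g g0; rewrite li; last first.
    move=> t tl; apply: sph_pull_ge0.
    by have [s sl <-] := im2 t tl; exact: g0.
  apply: eq_integral => t; rewrite inE/= in_itv/= => tl.
  rewrite /sph_pull -muleA -EFinM /w /conformal_factor -exprMn mulVf ?expr1n ?mule1 -?fE//.
  by rewrite gt_eqF// ltr_wpDr ?mdist_ge0.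
Unshelve. all: by end_near. Qed.

Lemma upper_gradient_along_conformal (E : set X) (v g : S -> \bar R) c c' :
  conformal_curves c c' -> curves_in E c -> (forall x, E x -> 0 <= g (emb x))%E ->
  upper_gradient_along v g c' <->
  upper_gradient_along (v \o emb) (sph_pull g) c.
Proof.
move=> [_ c0 cl li] cE g0; rewrite /upper_gradient_along c0 cl li//.
by move=> t /cE /g0.
Qed.

End conformal_curves.

(** * Topology and measurability of the sphericalization *)

Section sph_topology.
Context (R : realType) (d : measure_display) (X : borelMetricType d R) (a : X).
Local Notation S := (sphericalization a).
Local Notation emb := (Some : X -> S).
Local Notation conf := (conformal_factor a).
Implicit Types (x y : X) (z : S) (E : set X).

Lemma preimage_sph_set E : emb @^-1` (sph_set a E) = E.
Proof.
by apply/seteqP; split=> [x [y Ey [<-]]|x Ex] //; exists x.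
Qed.

Lemma sph_set_emb E x : sph_set a E (emb x) <-> E x.
Proof. by split=> [[y Ey [<-]]|Ex] //; exists x. Qed.

Lemma sph_set_preimageI E (B : set S) :
  sph_set a E `&` B = sph_set a (E `&` emb @^-1` B).
Proof.
apply/seteqP; split=> [z [[x Ex <-] Bx]|_ [x [Ex Bx] <-]].
  by exists x.
by split => //; exists x.
Qed.

(** Infinity is at distance at least h(x) from x, so radius h(x)/2 excludes it; within that radius d
    <= dhat / c^2 with c = h(x)/2. *)
Lemma sph_mdist_small x (e : R) : 0 < e -> exists2 r, 0 < r &
  forall z, mdist (emb x) z < r -> exists2 y, z = emb y & mdist x y < e.
Proof.
move=> e0; have h0 := conf_gt0 a x; pose c := conf x / 2.
have c0 : 0 < c by rewrite divr_gt0.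
exists (Num.min c (e * c ^+ 2)) => [|z].
  by rewrite lt_min c0 mulr_gt0// exprn_gt0.
rewrite lt_min => /andP[h1 h2]; case: z h1 h2 => [y|] h1 h2; last first.
  have := sph_conf_lip (emb x) (None : S); rewrite /= subr0 gtr0_norm//.
  by rewrite /c in h1 *; move=> h3; lra.
exists y => //; rewrite -(ltr_pM2r (exprn_gt0 2 c0)); apply: le_lt_trans h2.
by apply: sph_mdist_lower_bound; [exact: ltW|rewrite /c in h1 *; lra].
Qed.

(** X is an open subspace of the sphericalization: [emb] is continuous because dhat <= d, and open
    by [sph_mdist_small]. The topological transfers rest on this. *)
Lemma sph_nbhs x (A : set S) : nbhs (emb x) A <-> nbhs x (emb @^-1` A).
Proof.
split=> /nbhs_ballP[e /= e0 eA]; apply/nbhs_ballP.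
  exists e => //= y xy; apply: eA; move: xy; rewrite !ballEmdist/=.
  exact/le_lt_trans/sph_mdist_le_mdist.
have [r r0 H] := sph_mdist_small x e0; exists r => //= z.
rewrite ballEmdist/= => /H[y -> xy]; apply: (eA y).
by rewrite ballEmdist.
Qed.

Lemma emb_continuous : continuous emb.
Proof. by move=> x A /sph_nbhs. Qed.

Lemma open_preimage_emb (U : set S) : open U -> open (emb @^-1` U).
Proof. by move/continuousP : emb_continuous; exact. Qed.

Lemma open_sph_set E : open E -> open (sph_set a E).
Proof.
rewrite !openE => oE _ [x Ex <-]; rewrite /interior; apply/sph_nbhs.
by rewrite preimage_sph_set; exact: oE.
Qed.

(** An inverse of [emb], continuous on the image of X; the value at infinity is arbitrary. *)
Definition sph_retract z : X := if z is Some x then x else a.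

Lemma sph_retract_continuous E : {within sph_set a E, continuous sph_retract}.
Proof.
apply/subspace_continuousP => _ [x Ex <-] /= A xA.
have : nbhs (emb x) (sph_retract @^-1` A) by apply/sph_nbhs.
by apply: filterS => z Az _.
Qed.

Lemma continuous_within_sph (T : topologicalType) E (v : S -> T) :
  {within E, continuous (v \o emb)} <->
  {within sph_set a E, continuous v}.
Proof.
split=> /subspace_continuousP H; apply/subspace_continuousP.
  move=> _ [x Ex <-] A /(H x Ex) xA.
  suff : nbhs (emb x) [set z | sph_set a E z -> A (v z)] by [].
  apply/sph_nbhs; have : nbhs x [set y | E y -> A (v (emb y))] by [].
  by apply: filterS => y yA /sph_set_emb.
move=> x Ex A /(H _ (imageP _ Ex)) xA.
suff : nbhs x [set y | E y -> A (v (emb y))] by [].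
have /sph_nbhs : nbhs (emb x) [set z | sph_set a E z -> A (v z)] by [].
by apply: filterS => y /= yA Ey; apply: yA; exact/sph_set_emb.
Qed.

Lemma connected_sph_set (B : set X) : connected B -> connected (sph_set a B).
Proof.
move=> cB; apply: connected_continuous_connected => //.
exact/continuous_subspaceT/emb_continuous.
Qed.

Lemma connected_component_sph E x y :
  connected_component (sph_set a E) (emb x) (emb y) <-> connected_component E x y.
Proof.
split=> [[C [Cx CE cC] Cy]|[C [Cx CE cC] Cy]].
  exists (sph_retract @` C); last by exists (emb y).
  split; first by exists (emb x).
    by move=> _ [z /CE[u Eu <-] <-].
  apply: connected_continuous_connected cC _.
  apply: continuous_subspaceW (@sph_retract_continuous E).
  exact: CE.
exists (sph_set a C); last exact/sph_set_emb.
split; first exact/sph_set_emb.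
  by apply: image_subset.
exact: connected_sph_set.
Qed.

Lemma compact_sph_set (K : set X) : compact (sph_set a K) <-> compact K.
Proof.
split=> cK.
  have -> : K = sph_retract @` (sph_set a K).
    by rewrite image_comp /= image_id.
  apply: continuous_compact cK; exact: sph_retract_continuous.
by apply: continuous_compact cK; exact/continuous_subspaceT/emb_continuous.
Qed.

Lemma closure_preimage_emb (A : set S) :
  emb @^-1` (closure A) = closure (emb @^-1` A).
Proof.
apply/seteqP; split=> x xA B.
  move=> xB; have [|z [Az [y By yz]]] := xA (sph_set a B).
    by apply/sph_nbhs; rewrite preimage_sph_set.
  by exists y; split => //; rewrite /= yz.
by move=> /sph_nbhs/xA[y [Ay By]]; exists (emb y).
Qed.

End sph_topology.

Section sph_measurability.
Context (R : realType) (d : measure_display) (X : borelMetricType d R) (a : X).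
Local Notation S := (sphericalization a).
Local Notation emb := (Some : X -> S).
Local Notation conf := (conformal_factor a).
Implicit Types (x y : X) (z : S) (E : set X).

Lemma measurable_sph_set E : measurable E -> measurable (sph_set a E).
Proof. by move=> mE; rewrite /measurable/= /sph_measurable/= preimage_sph_set. Qed.

Lemma emb_measurable : measurable_fun setT emb.
Proof. by move=> _ A mA; rewrite setTI. Qed.

Lemma measurable_fun_sph d' (T : measurableType d') E (g : S -> T) :
  measurable E -> measurable_fun (sph_set a E) g <-> measurable_fun E (g \o emb).
Proof.
move=> mE; split=> mg _ Y mY.
  have := mg (measurable_sph_set mE) Y mY.
  by rewrite {1}/measurable/= /sph_measurable/= preimage_setI preimage_sph_set.
rewrite {1}/measurable/= /sph_measurable/= preimage_setI preimage_sph_set.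
exact: mg.
Qed.

Lemma borel_measurable (T : borelMetricType d R) (A : set T) :
  measurable (A : set (g_sigma_algebraType (@open T))) -> measurable A.
Proof.
apply: smallest_sub; last exact: borel_open_measurable.
exact: sigma_algebra_measurable.
Qed.

Lemma borel_fun_measurable (T : borelMetricType d R) (E : set T) (g : T -> \bar R) :
  open E -> borel_fun E g -> measurable_fun E g.
Proof.
move=> oE bg _ Y mY; apply: borel_measurable; apply: bg => //.
exact: sub_sigma_algebra.
Qed.

(** Borel functions refer to the sigma-algebra generated by the open sets, possibly smaller than the
    ambient one, so they need a transfer separate from [measurable_fun_sph]. *)
Lemma borel_sph_set (A : set X) :
  measurable (A : set (g_sigma_algebraType (@open X))) ->
  measurable (sph_set a A : set (g_sigma_algebraType (@open S))).
Proof.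
pose G : set (set X) := [set B |
  measurable (sph_set a B : set (g_sigma_algebraType (@open S)))].
suff : <<s @open X >> `<=` G by exact.
apply: smallest_sub; last first.
  by move=> U oU; apply: sub_sigma_algebra; exact: open_sph_set.
split.
- by rewrite /G/= /sph_set image_set0; exact: measurable0.
- move=> B GB; rewrite /G/= setTD.
  (* Complements are taken relative to the image of X, which is open and hence Borel. *)
  have -> : sph_set a (~` B) = sph_set a setT `\` sph_set a B.
    apply/seteqP; split=> [_ [x nBx <-]|_ [[x _ <-] nBx]].
      by split; [exists x|move=> /sph_set_emb].
    by exists x => // Bx; apply: nBx; exists x.
  apply: measurableD => //; apply: sub_sigma_algebra; apply: open_sph_set.
  exact: openT.
- move=> F GF; rewrite /G/= /sph_set image_bigcup.
  by apply: bigcup_measurable => i _; exact: GF.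
Qed.

Lemma borel_preimage_emb (A : set S) :
  measurable (A : set (g_sigma_algebraType (@open S))) ->
  measurable (emb @^-1` A : set (g_sigma_algebraType (@open X))).
Proof.
pose G : set (set S) := [set B |
  measurable (emb @^-1` B : set (g_sigma_algebraType (@open X)))].
suff : <<s @open S >> `<=` G by exact.
apply: smallest_sub; last first.
  move=> U oU; apply: sub_sigma_algebra.
  exact: open_preimage_emb.
split.
- by rewrite /G/= preimage_set0; exact: measurable0.
- by move=> B GB; rewrite /G/= setTD preimage_setC; exact: measurableC.
- move=> F GF; rewrite /G/= preimage_bigcup.
  by apply: bigcup_measurable => i _; exact: GF.
Qed.

Lemma borel_fun_sph E (g : S -> \bar R) : open E ->
  borel_fun (sph_set a E) g <-> borel_fun E (g \o emb).
Proof.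
move=> oE; split=> bg _ Y mY.
  have := bg _ Y mY; rewrite sph_set_preimageI => /(_ _)/borel_preimage_emb.
  rewrite preimage_sph_set; apply.
  by apply: sub_sigma_algebra; exact: open_sph_set.
rewrite sph_set_preimageI; apply: borel_sph_set; apply: bg => //.
exact: sub_sigma_algebra.
Qed.

Lemma conf_continuous : continuous conf.
Proof.
move=> x; apply/(@cvgrPdist_lt _ R) => e e0; near=> y.
have := sph_conf_lip (emb x) (emb y) => /le_lt_trans; apply.
apply: le_lt_trans (sph_mdist_le_mdist _ _ _) _.
near: y; apply/nbhs_ballP; exists e => //= y; by rewrite ballEmdist.
Unshelve. all: by end_near. Qed.

Lemma conf_sqr_continuous : continuous (fun x => conf x ^+ 2).
Proof.
move=> x; apply: (@continuous_comp _ _ _ conf (fun t : R => t ^+ 2)).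
  exact: conf_continuous.
exact: exprn_continuous.
Qed.

Lemma conf_sqrV_continuous : continuous (fun x => (conf x ^+ 2)^-1).
Proof.
move=> x; apply: cvgV; first by rewrite gt_eqF// exprn_gt0// conf_gt0.
exact: conf_sqr_continuous.
Qed.

Lemma continuous_borel_fun (E : set X) (f : X -> R) :
  continuous f -> borel_fun E (EFin \o f).
Proof.
move=> cf; apply/measurable_EFinP; apply: measurable_funTS => _.
apply: (measurability _ (RGenOpens.measurableE R)) => //.
move=> _ [_ [u [v ->]] <-]; rewrite setTI; apply: sub_sigma_algebra.
by move/continuousP : cf; apply; exact: interval_open.
Qed.

End sph_measurability.

(** * Gradients and energies on the sphericalization *)

Lemma metric_ball_open (R : realType) (T : metricType R) (x : T) (r : R) :
  open (ball x r).
Proof.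
rewrite openE => y; rewrite ballEmdist/= => xy.
apply/nbhs_ballP; exists (r - mdist x y); first by rewrite /= subr_gt0.
move=> z; rewrite !ballEmdist/= ltrBrDl; apply: le_lt_trans.
exact: metric_triangle.
Qed.

Section sph_measure.
Context (R : realType) (d : measure_display) (X : borelMetricType d R) (a : X).
Variables (mu : {measure set X -> \bar R}) (p : R).
Local Notation S := (sphericalization a).
Local Notation emb := (Some : X -> S).
Local Notation conf := (conformal_factor a).
Local Notation pull := (@sph_pull R d X a).
Let muhat : {measure set S -> \bar R} := sph_measure a p mu.
Implicit Types (x y : X) (z : S) (E : set X) (g v : S -> \bar R).

(** Inverse of [sph_pull] away from infinity; it transports competing densities from X to the
    sphericalization. *)
Definition sph_push (g : X -> \bar R) z : \bar R :=
  if z is Some x then (g x * ((conf x ^+ 2)^-1)%:E)%E else 0%E.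

Let conf2_gt0 x : 0 < conf x ^+ 2.
Proof. by rewrite exprn_gt0// conf_gt0. Qed.

Lemma sph_pushK (g : X -> \bar R) : pull (sph_push g) = g.
Proof.
apply/funext => x; rewrite /sph_pull/= -muleA -EFinM mulVf ?mule1//.
by rewrite gt_eqF.
Qed.

Lemma sph_pullE (g : S -> \bar R) x :
  (pull g x * ((conf x ^+ 2)^-1)%:E)%E = g (emb x).
Proof. by rewrite /sph_pull -muleA -EFinM mulfV ?mule1// gt_eqF. Qed.

Lemma sph_push_ge0 (g : X -> \bar R) x : (0 <= g x)%E -> (0 <= sph_push g (emb x))%E.
Proof. by move=> g0; rewrite mule_ge0// lee_fin invr_ge0 ltW. Qed.

Lemma borel_fun_sph_pull E g : open E ->
  borel_fun E (pull g) <-> borel_fun (sph_set a E) g.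
Proof.
move=> oE; rewrite borel_fun_sph//; split => bg.
  have -> : g \o emb = fun x => (pull g x * ((conf x ^+ 2)^-1)%:E)%E.
    by apply/funext => x; rewrite /= sph_pullE.
  apply: emeasurable_funM => //.
  apply: (@continuous_borel_fun _ _ _ E (fun x => (conf x ^+ 2)^-1)).
  exact: conf_sqrV_continuous.
apply: emeasurable_funM => //.
apply: (@continuous_borel_fun _ _ _ E (fun x => conf x ^+ 2)).
exact: conf_sqr_continuous.
Qed.

Lemma measurable_fun_sph_pull E g : measurable E ->
  measurable_fun E (pull g) <-> measurable_fun (sph_set a E) g.
Proof.
move=> mE; rewrite measurable_fun_sph//; split => mg.
  have -> : g \o emb = fun x => (pull g x * ((conf x ^+ 2)^-1)%:E)%E.
    by apply/funext => x; rewrite /= sph_pullE.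
  apply: emeasurable_funM => //; apply: (measurable_funS _ (@subsetT _ E)) => //.
  apply: borel_fun_measurable; first exact: openT.
  apply: (@continuous_borel_fun _ _ _ setT (fun x => (conf x ^+ 2)^-1)).
  exact: conf_sqrV_continuous.
apply: emeasurable_funM => //; apply: (measurable_funS _ (@subsetT _ E)) => //.
apply: borel_fun_measurable; first exact: openT.
apply: (@continuous_borel_fun _ _ _ setT (fun x => conf x ^+ 2)).
exact: conf_sqr_continuous.
Qed.

Let weightE x : (1 + mdist x a) `^ (- (2 * p)) = (conf x ^+ 2) `^ p.
Proof.
have w0 : 0 <= 1 + mdist x a by rewrite addr_ge0 ?mdist_ge0.
rewrite -mulNr powRrM (powR_invn 2 w0); congr powR.
by rewrite /conformal_factor exprVn.
Qed.

Let measurable_weight :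
  measurable_fun setT (fun x => (1 + mdist x a) `^ (- (2 * p))).
Proof.
under eq_fun do rewrite weightE.
apply: (measurableT_comp (measurable_powR _)); apply/measurable_EFinP.
apply: borel_fun_measurable; first exact: openT.
apply: (@continuous_borel_fun _ _ _ setT (fun x => conf x ^+ 2)).
exact: conf_sqr_continuous.
Qed.

Lemma ge0_integral_sph_measure (A : set X) v : measurable A ->
  measurable_fun A (v \o emb) -> (forall x, A x -> 0 <= v (emb x))%E ->
  (\int[muhat]_(z in sph_set a A) v z =
   \int[mu]_(x in A) (v (emb x) * ((conf x ^+ 2) `^ p)%:E))%E.
Proof.
move=> mA mv v0.
have muhatE (B : set S) : measurable B ->
    muhat B = (\int[mu]_(x in emb @^-1` B) ((1 + mdist x a) `^ (- (2 * p)))%:E)%E.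
  by [].
have w_ge0 x : 0 <= (1 + mdist x a) `^ (- (2 * p)) by exact: powR_ge0.
have mv' : measurable_fun (sph_set a A) v by exact/measurable_fun_sph.
have v0' z : sph_set a A z -> (0 <= v z)%E by move=> [x Ax <-]; exact: v0.
have := ge0_change_of_variables (@emb_measurable _ _ _ a) measurable_weight
  w_ge0 muhatE (measurable_sph_set a mA) mv' v0'.
move=> ->; rewrite preimage_sph_set.
by apply: eq_integral => x _; rewrite weightE.
Qed.

(* The weight of the measure cancels the p-th power of the conformal factor. *)
Lemma integral_sph_pull_pow (A : set X) g : measurable A ->
  measurable_fun (sph_set a A) g ->
  (\int[muhat]_(z in sph_set a A) (`|g z| `^ p) =
   \int[mu]_(x in A) (`|pull g x| `^ p))%E.
Proof.
move=> mA mg.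
rewrite (@ge0_integral_sph_measure A (fun z => `|g z| `^ p)%E)//.
- apply: eq_integral => x _.
  rewrite /sph_pull abseM (@gee0_abs _ (_ ^+ 2)%:E) ?lee_fin ?sqr_ge0//.
  by rewrite poweRM ?lee_fin ?sqr_ge0.
- apply: (measurableT_comp (measurable_poweR _)).
  apply: measurableT_comp => //; exact/measurable_fun_sph.
- by move=> x _; exact: poweR_ge0.
Qed.

Lemma ge0_integral_sph_pull_pow (A : set X) g : measurable A ->
  measurable_fun (sph_set a A) g -> (forall x, A x -> 0 <= g (emb x))%E ->
  (\int[muhat]_(z in sph_set a A) (g z `^ p) =
   \int[mu]_(x in A) (pull g x `^ p))%E.
Proof.
move=> mA mg g0; transitivity (\int[muhat]_(z in sph_set a A) (`|g z| `^ p))%E.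
  by apply: eq_integral => z; rewrite inE => -[x Ax <-]; rewrite gee0_abs// g0.
rewrite integral_sph_pull_pow//; apply: eq_integral => x; rewrite inE => Ax.
by rewrite gee0_abs// sph_pull_ge0// g0.
Qed.

(** The density of [muhat] with respect to [mu] is positive and finite, and infinity has measure
    zero. *)
Lemma negligible_sph (N : set S) :
  muhat.-negligible N <-> mu.-negligible (emb @^-1` N).
Proof.
have mw : measurable_fun setT (fun x => ((conf x ^+ 2) `^ p)%:E).
  apply/measurable_EFinP; under eq_fun do rewrite -weightE.
  exact: measurable_weight.
have w0 x : 0 < (conf x ^+ 2) `^ p by rewrite powR_gt0.
have muhatE (A : set S) : muhat A = (\int[mu]_(x in emb @^-1` A) ((conf x ^+ 2) `^ p)%:E)%E.
  by apply: eq_integral => x _; rewrite weightE.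
split=> [[A [mA A0 NA]]|[A [mA A0 NA]]].
  have mB : measurable (emb @^-1` A) by exact: mA.
  exists (emb @^-1` A); split => //; last by move=> x /NA.
  (* [V] is the reciprocal density, so its integral with respect to [muhat] recovers [mu]. *)
  pose V z : \bar R := if z is Some x then (((conf x ^+ 2) `^ p)^-1)%:E else 0%E.
  have mV : measurable_fun (emb @^-1` A) (V \o emb).
    apply/measurable_EFinP.
    have -> : (fun x => ((conf x ^+ 2) `^ p)^-1) =
        (fun x => ((conf x ^+ 2)^-1) `^ p).
      apply/funext => x; rewrite -powRN -(powR_inv1 (ltW (conf2_gt0 x))).
      by rewrite -powRrM mulN1r.
    apply: (measurableT_comp (measurable_powR _)); apply/measurable_EFinP.
    apply: (measurable_funS _ (@subsetT _ _)) => //.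
    apply: borel_fun_measurable; first exact: openT.
    apply: (@continuous_borel_fun _ _ _ setT (fun x => (conf x ^+ 2)^-1)).
    exact: conf_sqrV_continuous.
  have <- : (\int[muhat]_(z in sph_set a (emb @^-1` A)) V z)%E = mu (emb @^-1` A).
    rewrite ge0_integral_sph_measure//; last first.
      by move=> x _; rewrite lee_fin invr_ge0 ltW.
    rewrite -[RHS]mul1e -integral_cst//; apply: eq_integral => x _.
    by rewrite -EFinM mulVf// gt_eqF.
  apply: null_set_integral; first exact: measurable_sph_set.
    exact/measurable_fun_sph.
  by rewrite -A0 !muhatE preimage_sph_set.
(* Infinity is included because [N] may contain it. *)
exists [set z | if z is Some x then A x else True]; split => //.
  rewrite muhatE; apply: null_set_integral => //.
  exact: measurable_funTS.
by case=> [x|] //= Nx; exact: NA.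
Qed.

Lemma ae_sph (P : S -> Prop) :
  {ae muhat, forall z, P z} <-> {ae mu, forall x, P (emb x)}.
Proof. exact: (negligible_sph (~` [set z | P z])). Qed.

(** Admissible densities correspond under [sph_push] and [sph_pull]. The families are related in
    both directions rather than by a bijection, since corresponding curves are obtained by existence
    statements. *)
Lemma modulus_sph E (G : set (curve X)) (G' : set (curve S)) : open E ->
  G `<=` curves_in E -> G' `<=` curves_in (sph_set a E) ->
  (forall c, G c -> exists2 c', G' c' & conformal_curves c c') ->
  (forall c', G' c' -> exists2 c, G c & conformal_curves c c') ->
  modulus mu p E G = modulus muhat p (sph_set a E) G'.
Proof.
move=> oE GE GE' GG' G'G; have mE := borel_open_measurable E oE.
rewrite /modulus; congr ereal_inf; apply/seteqP; split.
  move=> _ [rho [brho rho0 adm] <-]; exists (sph_push rho); last first.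
    rewrite ge0_integral_sph_pull_pow//; first by rewrite sph_pushK.
    - apply/measurable_fun_sph_pull => //; rewrite sph_pushK.
      exact: borel_fun_measurable.
    - by move=> x Ex; apply: sph_push_ge0; exact: rho0.
  split.
  - by apply/borel_fun_sph_pull; rewrite ?sph_pushK.
  - by move=> _ [x Ex <-]; apply: sph_push_ge0; exact: rho0.
  - move=> c' /G'G[c Gc [_ _ _ ->]]; first by rewrite sph_pushK; exact: adm.
    by move=> t /(GE c Gc) Ec; apply: sph_push_ge0; exact: rho0.
move=> _ [rho [brho rho0 adm] <-]; exists (pull rho); last first.
  rewrite -ge0_integral_sph_pull_pow//.
    by apply: borel_fun_measurable => //; exact: open_sph_set.
  by move=> x Ex; apply: rho0; exists x.
split.
- exact/borel_fun_sph_pull.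
- by move=> x Ex; apply: sph_pull_ge0; apply: rho0; exists x.
- move=> c Gc; have [c' Gc' [_ _ _ li]] := GG' c Gc.
  rewrite -li; first exact: adm.
  by move=> t /(GE c Gc) Ec; apply: rho0; exists (c t).
Qed.

Lemma curves_in_setT E (c' : curve S) :
  curves_in (sph_set a E) c' -> curves_in (sph_set a [set: X]) c'.
Proof. by move=> H t /H [x _ <-]; exists x. Qed.

Lemma upper_gradient_sph E v g : open E ->
  upper_gradient (sph_set a E) v g <-> upper_gradient E (v \o emb) (pull g).
Proof.
move=> oE; split=> [[bg g0 ug]|[bg g0 ug]].
  have g0' x : E x -> (0 <= g (emb x))%E by move=> Ex; apply: g0; exists x.
  split.
  - exact/borel_fun_sph_pull.
  - by move=> x /g0'; exact: sph_pull_ge0.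
  - move=> c Ec; have [c' cc'] := conformal_image a c.
    apply/(upper_gradient_along_conformal _ cc' Ec g0'); apply: ug.
    by case: cc' => H _ _ _; exact/H.
have g0' x : E x -> (0 <= g (emb x))%E.
  by move=> /g0; rewrite -sph_pullE => h; rewrite mule_ge0// lee_fin invr_ge0 ltW.
split.
- exact/borel_fun_sph_pull.
- by move=> _ [x Ex <-]; exact: g0'.
- move=> c' Ec'; have [c cc'] := conformal_preimage (curves_in_setT Ec').
  have Ec : curves_in E c by case: cc' => H _ _ _; exact/H.
  by apply/(upper_gradient_along_conformal _ cc' Ec g0'); exact: ug.
Qed.

Lemma weak_upper_gradient_sph E v g : open E ->
  weak_upper_gradient muhat p (sph_set a E) v g <->
  weak_upper_gradient mu p E (v \o emb) (pull g).
Proof.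
move=> oE; have mE := borel_open_measurable E oE.
split=> [[mg g0 [G' [GE' mod0 ug]]]|[mg g0 [G [GE mod0 ug]]]].
  have g0' x : E x -> (0 <= g (emb x))%E by move=> Ex; apply: g0; exists x.
  split.
  - exact/measurable_fun_sph_pull.
  - by move=> x /g0'; exact: sph_pull_ge0.
  (* A curve is exceptional as soon as one of its counterparts is, so no counterpart of a remaining
     curve is exceptional. *)
  - exists [set c | curves_in E c /\ exists2 c', G' c' & conformal_curves c c'].
    split; first by move=> c [].
      rewrite -mod0; apply: modulus_sph => //; first by move=> c [].
        by move=> c [].
      move=> c' Gc'; have [c cc'] := conformal_preimage (curves_in_setT (GE' _ Gc')).
      exists c => //; split; last by exists c'.
      by case: cc' => H _ _ _; apply/H; exact: GE'.
    move=> c Ec nGc; have [c' cc'] := conformal_image a c.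
    apply/(upper_gradient_along_conformal _ cc' Ec g0'); apply: ug.
      by case: cc' => H _ _ _; exact/H.
    by move=> Gc'; apply: nGc; split => //; exists c'.
have g0' x : E x -> (0 <= g (emb x))%E.
  by move=> /g0; rewrite -sph_pullE => h; rewrite mule_ge0// lee_fin invr_ge0 ltW.
split.
- exact/measurable_fun_sph_pull.
- by move=> _ [x Ex <-]; exact: g0'.
- exists [set c' | curves_in (sph_set a E) c' /\ exists2 c, G c & conformal_curves c c'].
  split; first by move=> c [].
    rewrite -mod0; apply/esym; apply: modulus_sph => //; [by move=> c []| |by move=> c []].
    move=> c Gc; have [c' cc'] := conformal_image a c.
    exists c' => //; split; last by exists c.
    by case: cc' => H _ _ _; apply/H; exact: GE.
  move=> c' Ec' nGc'; have [c cc'] := conformal_preimage (curves_in_setT Ec').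
  have Ec : curves_in E c by case: cc' => H _ _ _; exact/H.
  apply/(upper_gradient_along_conformal _ cc' Ec g0'); apply: ug => // Gc.
  by apply: nGc'; split => //; exists c.
Qed.

(** As [P] passes to smaller open sets, both sides say that [P] holds on some neighbourhood of x in
    [E]; balls with different centres are compared through smaller balls centred at x. *)
Lemma local_sph (P : set X -> Prop) E x : open E ->
  (forall A B, open A -> open B -> A `<=` B -> P B -> P A) -> E x ->
  (exists (z : S) (r : R), ball z r (emb x) /\ P (E `&` emb @^-1` (ball z r))) <->
  (exists (y : X) (r : R), ball y r x /\ P (ball y r `&` E)).
Proof.
move=> oE mono Ex.
have oemb (z : S) (r : R) : open (emb @^-1` (ball z r)).
  exact/open_preimage_emb/metric_ball_open.
split=> [[z [r [zx Pz]]]|[y [r [yx Py]]]].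
  have /nbhs_ballP[e /= e0 eb] : nbhs x (emb @^-1` (ball z r)).
    by apply: open_nbhs_nbhs; split.
  exists x, e; split; first exact: ballxx.
  apply: mono Pz; [|exact: openI|by move=> u [/eb]].
  by apply: openI => //; exact: metric_ball_open.
have /sph_nbhs/nbhs_ballP[e /= e0 eb] : nbhs x (emb @^-1` (sph_set a (ball y r))).
  by rewrite preimage_sph_set; apply: open_nbhs_nbhs; split => //; exact: metric_ball_open.
exists (emb x), e; split; first exact: ballxx.
apply: mono Py.
- exact: openI.
- by apply: openI => //; exact: metric_ball_open.
- by move=> u [Eu /eb/sph_set_emb yu].
Qed.

Lemma Lp_loc_sph E g : open E ->
  Lp_loc muhat p (sph_set a E) g <-> Lp_loc mu p E (pull g).
Proof.
move=> oE; have mE := borel_open_measurable E oE.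
rewrite /Lp_loc -measurable_fun_sph_pull//.
have [mg|nmg] := pselect (measurable_fun E (pull g)); last by split=> -[].
(* The intersection with [E] is part of [P] because [g] is measurable on [E] only, while
   monotonicity is required for all open sets. *)
pose P U := (\int[mu]_(x in U `&` E) (`|pull g x| `^ p) < +oo)%E.
have mono A B : open A -> open B -> A `<=` B -> P B -> P A.
  move=> oA oB AB; apply: le_lt_trans; apply: ge0_subset_integral.
  - by apply: measurableI => //; exact: borel_open_measurable.
  - by apply: measurableI => //; exact: borel_open_measurable.
  - apply: (measurableT_comp (measurable_poweR _)); apply: measurableT_comp => //.
    by apply: measurable_funS mg => //; exact: subIsetr.
  - by move=> x _; exact: poweR_ge0.
  - by move=> x [/AB].
have PE (z : S) (r : R) : P (E `&` emb @^-1` (ball z r)) <->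
    (\int[muhat]_(z in ball z r `&` sph_set a E) (`|g z| `^ p) < +oo)%E.
  have mI : measurable (E `&` emb @^-1` (ball z r)).
    apply: measurableI => //; apply: borel_open_measurable.
    exact/open_preimage_emb/metric_ball_open.
  rewrite (setIC (ball z r)) sph_set_preimageI integral_sph_pull_pow//.
    by rewrite /P setIAC setIid.
  apply/measurable_fun_sph_pull => //; apply: measurable_funS mg => //.
split=> -[_ H]; split => //.
  move=> x Ex; have [z [r [zx /PE Pz]]] := H (emb x) (imageP _ Ex).
  have [|y [s [yx]]] := (local_sph oE mono Ex).1.
    by exists z, r.
  by rewrite /P -setIA setIid => ?; exists y, s.
move=> _ [x Ex <-]; have [y [r [yx Py]]] := H x Ex.
have [|z [s [zx]]] := (local_sph oE mono Ex).2.
  by exists y, r; split => //; rewrite /P -setIA setIid.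
by move=> /PE ?; exists z, s.
Qed.

(** Multiplication by h^2 preserves inequalities almost everywhere in both directions, and every
    competitor on X is the pullback of its [sph_push]. *)
Lemma minimal_weak_upper_gradient_sph E v g : open E ->
  is_minimal_weak_upper_gradient muhat p (sph_set a E) v g <->
  is_minimal_weak_upper_gradient mu p E (v \o emb) (pull g).
Proof.
move=> oE; have leE (g1 g2 : S -> \bar R) :
    {ae muhat, forall z, sph_set a E z -> (g1 z <= g2 z)%E} <->
    {ae mu, forall x, E x -> (pull g1 x <= pull g2 x)%E}.
  rewrite ae_sph.
  by split; apply: filterS => x H Ex; move: (H (iffRL (sph_set_emb _ _ _) Ex))
    || move: (H (iffLR (sph_set_emb _ _ _) Ex)); rewrite lee_pmul2r ?lte_fin.
split=> -[Lg wg ming]; split.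
- exact/Lp_loc_sph.
- exact/weak_upper_gradient_sph.
- move=> h Lh wh; rewrite -(sph_pushK h); apply/leE; apply: ming.
    by apply/Lp_loc_sph; rewrite ?sph_pushK.
  by apply/weak_upper_gradient_sph; rewrite ?sph_pushK.
- exact/Lp_loc_sph.
- exact/weak_upper_gradient_sph.
- move=> h Lh wh; apply/leE; apply: ming; first exact/Lp_loc_sph.
  exact/weak_upper_gradient_sph.
Qed.

(** The minimal gradients on the two spaces are chosen independently, so they correspond only almost
    everywhere, by minimality of each. If there is none on one side there is none on the other, and
    the default +oo is its own pullback. *)
Lemma energy_sph E (A : set X) v : open E -> open A -> A `<=` E ->
  (\int[muhat]_(z in sph_set a A)
     (minimal_weak_upper_gradient muhat p (sph_set a E) v z `^ p) =
   \int[mu]_(x in A)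
     (minimal_weak_upper_gradient mu p E (v \o emb) x `^ p))%E.
Proof.
move=> oE oA AE.
have [mA mE] := (borel_open_measurable A oA, borel_open_measurable E oE).
rewrite /minimal_weak_upper_gradient.
case: xgetP => [g _ /= ming|nming]; case: xgetP => [h _ /= minh|nminh].
- have [_ [mg g0 _] _] := ming; have [Lh wh minh'] := minh.
  have [mh h0 _] := wh.
  have [Lg wg ming'] := (minimal_weak_upper_gradient_sph v g oE).1 ming.
  have [mpg pg0 _] := wg.
  rewrite ge0_integral_sph_pull_pow//; last 2 first.
  + by apply/measurable_fun_sph_pull => //; exact: (measurable_funS mE AE).
  + by move=> x /AE Ex; apply: g0; exists x.
  have mpow f : measurable_fun E f -> measurable_fun A (fun x => (f x `^ p)%E).
    move=> mf; apply: (measurableT_comp (measurable_poweR _)).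
    exact: (measurable_funS mE AE).
  apply: ae_eq_integral => //; [exact: mpow|exact: mpow|].
  have := minh' _ Lg wg; have := ming' _ Lh wh.
  apply: filterS2 => x H1 H2 /AE Ex; congr poweR.
  by apply/eqP; rewrite eq_le H1// H2.
- by have /nminh := (minimal_weak_upper_gradient_sph v g oE).1 ming.
- by case: (nming (sph_push h)); apply/minimal_weak_upper_gradient_sph;
    rewrite ?sph_pushK.
- rewrite ge0_integral_sph_pull_pow//; last by move=> x _; exact: leey.
  apply: eq_integral => x _; congr poweR.
  by rewrite /sph_pull/= gt0_mulye// lte_fin.
Qed.

End sph_measure.

(** * Newtonian spaces, test functions and minimizers *)

Section newtonian.
Context (R : realType) (d : measure_display) (T : borelMetricType d R).
Variables (mu : {measure set T -> \bar R}) (p : R).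
Local Open Scope ereal_scope.

Lemma newtonianP (E : set T) (u : T -> \bar R) :
  newtonian mu p E u <->
  [/\ measurable_fun E u, \int[mu]_(x in E) (`|u x| `^ p) < +oo &
      exists2 g, upper_gradient E u g & \int[mu]_(x in E) (g x `^ p) < +oo].
Proof.
have I0 (g : T -> \bar R) : 0 <= \int[mu]_(x in E) (g x `^ p).
  by apply: integral_ge0 => x _; exact: poweR_ge0.
rewrite /newtonian /newtonian_norm_pow; split=> [[mu' N]|[mu' Iu [g ug Ig]]].
  have inf0 : 0 <= ereal_inf [set \int[mu]_(x in E) (g x `^ p) | g in upper_gradient E u].
    by apply: le_ereal_inf_tmp => _ [g _ <-].
  split => //; first by apply: le_lt_trans N; rewrite leeDl.
  have : ereal_inf [set \int[mu]_(x in E) (g x `^ p) | g in upper_gradient E u] < +oo.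
    by apply: le_lt_trans N; rewrite leeDr.
  by move=> /ereal_inf_lt[_ [g ug <-] Ig]; exists g.
split => //; rewrite lte_add_pinfty//; apply: le_lt_trans Ig.
by apply: ereal_inf_lbound; exists g.
Qed.

Lemma upper_gradientS (A B : set T) (u g : T -> \bar R) :
  open A -> open B -> A `<=` B -> upper_gradient B u g -> upper_gradient A u g.
Proof.
move=> oA oB AB [bg g0 ug]; split.
- apply: measurable_funS bg => //; exact: sub_sigma_algebra.
- by move=> x /AB; exact: g0.
- by move=> c Ac; apply: ug => t /Ac /AB.
Qed.

Lemma newtonianS (A B : set T) (u : T -> \bar R) :
  open A -> open B -> A `<=` B -> newtonian mu p B u -> newtonian mu p A u.
Proof.
move=> oA oB AB /newtonianP[mB Iu [g ug Ig]]; apply/newtonianP.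
have [mA mB'] := (borel_open_measurable A oA, borel_open_measurable B oB).
have mpow (f : T -> \bar R) : measurable_fun B f -> measurable_fun B (fun x => f x `^ p).
  exact: (measurableT_comp (measurable_poweR _)).
split; first exact: measurable_funS mB.
- apply: le_lt_trans Iu; apply: ge0_subset_integral => //.
    by apply: mpow; exact: measurableT_comp.
  by move=> x _; exact: poweR_ge0.
- exists g; first exact: upper_gradientS ug.
  apply: le_lt_trans Ig; apply: ge0_subset_integral => //.
    by apply: mpow; case: ug => bg _ _; exact: borel_fun_measurable.
  by move=> x _; exact: poweR_ge0.
Qed.

End newtonian.

Section sph_potential_theory.
Context (R : realType) (d : measure_display) (X : borelMetricType d R) (a : X).
Variables (mu : {measure set X -> \bar R}) (p : R).
Hypothesis p_gt0 : 0 < p.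
Local Notation S := (sphericalization a).
Local Notation emb := (Some : X -> S).
Local Notation conf := (conformal_factor a).
Local Notation pull := (@sph_pull R d X a).
Let muhat : {measure set S -> \bar R} := sph_measure a p mu.
Implicit Types (x y : X) (z : S) (E : set X) (g v : S -> \bar R).

(** The gradient terms agree exactly, but no factor of |v|^p compensates the weight of the measure.
    That weight lies between (c^2)^p and 1 on [U], so both integrals of |v|^p are finite
    together. *)
Lemma newtonian_sph (U : set X) v (c : R) : open U -> 0 < c ->
  (forall x, U x -> c <= conf x) ->
  newtonian muhat p (sph_set a U) v <-> newtonian mu p U (v \o emb).
Proof.
move=> oU c0 cU; have mU := borel_open_measurable U oU.
have c2 : 0 < (c ^+ 2) `^ p by rewrite powR_gt0// exprn_gt0.
suff IE : measurable_fun U (v \o emb) ->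
    (\int[muhat]_(z in sph_set a U) (`|v z| `^ p) < +oo <->
     \int[mu]_(x in U) (`|v (emb x)| `^ p) < +oo)%E.
  split=> /newtonianP[mv Iv [g ug Ig]]; apply/newtonianP.
    have {}mv : measurable_fun U (v \o emb) by exact/measurable_fun_sph.
    split => //; first exact/(IE mv).
    exists (pull g); first exact/upper_gradient_sph.
    case: ug => bg g0 _; rewrite -ge0_integral_sph_pull_pow//.
      by apply: borel_fun_measurable => //; exact: open_sph_set.
    by move=> x Ux; apply: g0; exists x.
  split; [exact/measurable_fun_sph|exact/(IE mv)|exists (sph_push g)].
    by apply/upper_gradient_sph; rewrite ?sph_pushK.
  case: ug => bg g0 _; rewrite ge0_integral_sph_pull_pow// ?sph_pushK//.
  - apply/measurable_fun_sph_pull => //; rewrite sph_pushK.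
    exact: borel_fun_measurable.
  - by move=> x Ux; apply: sph_push_ge0; exact: g0.
move=> mv.
have mvp : measurable_fun U (fun x => `|v (emb x)| `^ p)%E.
  apply: (measurableT_comp (measurable_poweR _)).
  exact: measurableT_comp.
rewrite (@ge0_integral_sph_measure R d X a mu p U (fun z => `|v z| `^ p)%E)//; last first.
  by move=> x _; exact: poweR_ge0.
split=> Iv; last first.
  apply: le_lt_trans Iv; apply: ge0_le_lower_integral.
  - by move=> x _; rewrite mule_ge0 ?poweR_ge0// lee_fin powR_ge0.
  - move=> x _; rewrite -[leRHS]mule1 lee_wpmul2l ?poweR_ge0// lee_fin.
    apply: (@le_trans _ _ (1 `^ p)); last by rewrite powR1.
    rewrite ge0_ler_powR ?nnegrE ?(ltW p_gt0) ?sqr_ge0//.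
    by rewrite expr_le1// ?conf_le1// ltW// conf_gt0.
have vp_ge0 x : U x -> (0 <= `|v (emb x)| `^ p)%E by move=> _; exact: poweR_ge0.
have le_weight : (\int[mu]_(x in U) (((c ^+ 2) `^ p)%:E * `|v (emb x)| `^ p) <=
    \int[mu]_(x in U) (`|v (emb x)| `^ p * ((conf x ^+ 2) `^ p)%:E))%E.
  apply: ge0_le_lower_integral => x Ux.
    by rewrite mule_ge0 ?poweR_ge0// lee_fin powR_ge0.
  rewrite muleC lee_wpmul2l ?poweR_ge0// lee_fin.
  rewrite ge0_ler_powR ?nnegrE ?(ltW p_gt0) ?sqr_ge0//.
  by rewrite ler_sqr ?nnegrE ?(ltW c0) ?(ltW (conf_gt0 _ _))// cU.
move: le_weight; rewrite (ge0_integralZl_EFin mu mU vp_ge0 mvp (ltW c2)).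
move=> /le_lt_trans/(_ Iv) kI.
rewrite ltey; apply/eqP => Ioo.
by move: kI; rewrite Ioo gt0_muley ?lte_fin.
Qed.

Lemma newtonian_loc_sph E v : open E ->
  newtonian_loc muhat p (sph_set a E) v <-> newtonian_loc mu p E (v \o emb).
Proof.
move=> oE.
pose P U := newtonian muhat p (sph_set a U) v.
have mono A B : open A -> open B -> A `<=` B -> P B -> P A.
  move=> oA oB AB; apply: newtonianS; [exact: open_sph_set..|].
  exact: image_subset.
have PE (z : S) (r : R) : P (E `&` emb @^-1` (ball z r)) =
    newtonian muhat p (ball z r `&` sph_set a E) v.
  by rewrite /P (setIC (ball z r)) sph_set_preimageI.
have PE' (y : X) (r : R) : P (ball y r `&` E) <->
    newtonian mu p (ball y r `&` E) (v \o emb).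
  (* On the ball h is at least the inverse of 1 + d(y, a) + r. The radius is an arbitrary real; if
     this number is not positive, the ball is empty. *)
  have [r0|r0] := leP (1 + mdist y a + r) 0.
    have -> : ball y r `&` E = set0.
      rewrite -subset0 => x []; rewrite ballEmdist/= => yx _.
      by have := mdist_ge0 y x; have := mdist_ge0 y a; lra.
    by apply: (@newtonian_sph _ _ 1) => //; exact: open0.
  apply: (@newtonian_sph _ _ (1 + mdist y a + r)^-1).
  - by apply: openI => //; exact: metric_ball_open.
  - by rewrite invr_gt0.
  - move=> x []; rewrite ballEmdist/= => yx _.
    have w0 : 0 < 1 + mdist x a by rewrite ltr_wpDr ?mdist_ge0.
    rewrite /conformal_factor lef_pV2 ?posrE//.
    have := metric_triangle x y a; rewrite (metric_sym x y).
    by move=> ?; lra.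
split=> H.
  move=> x Ex; have [z [r [zx]]] := H (emb x) (imageP _ Ex).
  rewrite -PE => Pz; have [|y [s [yx /PE' Py]]] := (local_sph a oE mono Ex).1.
    by exists z, r.
  by exists y, s.
move=> _ [x Ex <-]; have [y [r [yx /PE' Py]]] := H x Ex.
have [|z [s [zx]]] := (local_sph a oE mono Ex).2; first by exists y, r.
by rewrite PE => Pz; exists z, s.
Qed.

Definition sph_extend (phi : X -> R) z : R := if z is Some x then phi x else 0.

Lemma sph_support (phi : S -> R) : phi None = 0 ->
  [set z | phi z != 0] = sph_set a [set x | phi (emb x) != 0].
Proof.
move=> phi0; apply/seteqP; split=> [[x|] /= h|_ [x /= h <-]] //.
  by exists x.
by rewrite phi0 eqxx in h.
Qed.

Lemma test_function_sph_infty E (phi : S -> R) :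
  test_function (sph_set a E) phi -> phi None = 0.
Proof.
case=> _ _ supp; apply/eqP/negPn/negP => phi0.
by have [] : sph_set a E None by apply: supp; exact: subset_closure.
Qed.

Lemma test_function_emb E (phi : S -> R) :
  test_function (sph_set a E) phi -> test_function E (phi \o emb).
Proof.
case=> [[L phiL] cpt supp]; split.
- exists `|L| => x y; apply: le_trans (phiL (emb x) (emb y)) _.
  apply: (@le_trans _ _ (`|L| * mdist (emb x) (emb y))).
    by rewrite ler_wpM2r ?mdist_ge0// ler_norm.
  by rewrite ler_wpM2l// sph_mdist_le_mdist.
- have := @closure_preimage_emb _ _ _ a [set z | phi z != 0] => /= <-.
  rewrite -(@compact_sph_set _ _ _ a).
  have -> : sph_set a (emb @^-1` closure [set z | phi z != 0]) =
      closure [set z | phi z != 0].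
    apply/seteqP; split=> [_ [x xc <-]//|z zc].
    by have [x Ex xz] := supp z zc; exists x; rewrite //= xz.
  exact: cpt.
- have := @closure_preimage_emb _ _ _ a [set z | phi z != 0] => /= <-.
  by move=> x /supp /sph_set_emb.
Qed.

(** Being Lipschitz for dhat is a stronger requirement, as dhat <= d. It holds because [phi] is
    bounded and h is bounded below on the compact support: distant pairs are handled by the bound on
    [phi], close ones by local comparability of the metrics. *)
Lemma test_function_extend E (phi : X -> R) :
  test_function E phi -> test_function (sph_set a E) (sph_extend phi).
Proof.
case=> [[L phiL] cpt supp].
set K := closure [set x | phi x != 0] in cpt supp.
(* The image of [K] is compact, hence closed, so the closure does not acquire the point at
   infinity. *)
have suppE : closure [set z | sph_extend phi z != 0] = sph_set a K.
  have cK : closed (sph_set a K).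
    by apply: compact_closed; [exact: metric_hausdorff|exact/compact_sph_set].
  rewrite (sph_support (phi := sph_extend phi))//.
  apply/seteqP; split.
    rewrite [X in _ `<=` X](closure_id _).1//; apply: closureS.
    by apply: image_subset; exact: subset_closure.
  move=> _ [x Kx <-].
  suff : (emb @^-1` closure (sph_set a [set x | phi x != 0])) x by [].
  by rewrite closure_preimage_emb preimage_sph_set.
split; last 2 first.
- by rewrite suppE; exact/compact_sph_set.
- by rewrite suppE; exact: image_subset.
have [M M0 KM] : exists2 M : R, 0 < M & forall x, K x -> 1 + mdist x a <= M.
  have cV : continuous (fun x => (conf x)^-1).
    by move=> x; apply: cvgV; [rewrite gt_eqF// conf_gt0|exact: conf_continuous].
  have /compact_bounded[N [_ NK]] : compact ((fun x => (conf x)^-1) @` K).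
    by apply: continuous_compact => //; exact: continuous_subspaceT.
  exists (Num.max N 0 + 1); first by rewrite ltr_wpDl// le_max lexx orbT.
  move=> x Kx; apply: le_trans (NK _ _ _ (imageP _ Kx)).
    by rewrite /conformal_factor invrK ler_norm.
  by rewrite (@le_lt_trans _ _ (Num.max N 0)) ?le_max ?lexx// ltrDl.
have suppK x : phi x != 0 -> K x by move=> h; exact: subset_closure.
pose B := `|phi a| + `|L| * M.
have B0 : 0 <= B by rewrite addr_ge0// mulr_ge0// ltW.
have phiB x : `|phi x| <= B.
  have [->|/suppK Kx] := eqVneq (phi x) 0; first by rewrite normr0.
  rewrite -(subrK (phi a) (phi x)) addrC; apply: le_trans (ler_normD _ _) _.
  rewrite lerD2l; apply: le_trans (phiL x a) _.
  apply: (@le_trans _ _ (`|L| * mdist x a)).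
    by rewrite ler_wpM2r ?mdist_ge0// ler_norm.
  by rewrite ler_wpM2l//; have := KM x Kx; lra.
have extB z : `|sph_extend phi z| <= B by case: z => [x|] /=; rewrite ?normr0.
(* For x in [K], h(x) >= 1/M. At dhat-distance at least h(x)/2 from x, the oscillation 2 B is at
   most 4 B M dhat; closer points lie in X and satisfy d <= 4 M^2 dhat. *)
pose C := 4 * B * M + `|L| * (4 * M ^+ 2).
have C1 : 0 <= 4 * B * M by rewrite !mulr_ge0// ltW.
have C2 : 0 <= `|L| * (4 * M ^+ 2) by rewrite mulr_ge0// mulr_ge0// sqr_ge0.
have H x z : phi x != 0 -> `|phi x - sph_extend phi z| <= C * mdist (emb x) z.
  move=> /suppK Kx; have h0 := conf_gt0 a x.
  have hM : 1 <= conf x * M.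
    have w0 : 0 < 1 + mdist x a by rewrite ltr_wpDr ?mdist_ge0.
    by rewrite mulrC /conformal_factor ler_pdivlMr// mul1r KM.
  have e0 := mdist_ge0 (emb x) z.
  have [he|he] := leP (conf x / 2) (mdist (emb x) z).
    apply: (@le_trans _ _ (2 * B)).
      apply: le_trans (ler_normB _ _) _.
      by rewrite [leRHS]mulr_natl mulr2n lerD.
    have h1 : conf x * M <= 2 * mdist (emb x) z * M by rewrite ler_pM2r//; lra.
    have : 2 * B * 1 <= 2 * B * (2 * mdist (emb x) z * M).
      by rewrite ler_wpM2l ?mulr_ge0//; lra.
    have : 0 <= `|L| * (4 * M ^+ 2) * mdist (emb x) z by rewrite mulr_ge0.
    by rewrite /C mulrDl; lra.
  case: z he e0 => [y|] he e0; last first.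
    have := sph_conf_lip (emb x) (None : S); rewrite /= subr0 gtr0_norm//.
    by move=> ?; exfalso; move: he; lra.
  have := @sph_mdist_lower_bound _ _ _ a x y (conf x / 2).
  rewrite divr_ge0 ?(ltW h0)// => /(_ isT) /(_ _) low.
  have {}low : mdist x y * (conf x / 2) ^+ 2 <= mdist (emb x) (emb y).
    by apply: low; move: he; lra.
  have dxy : mdist x y <= 4 * M ^+ 2 * mdist (emb x) (emb y).
    apply: (@le_trans _ _ (4 * M ^+ 2 * (mdist x y * (conf x / 2) ^+ 2))).
      rewrite [leRHS](_ : _ = mdist x y * (conf x * M) ^+ 2); last by field.
      by rewrite ler_peMr ?mdist_ge0// exprn_ege1.
    by rewrite ler_wpM2l// mulr_ge0// sqr_ge0.
  apply: le_trans (phiL x y) _.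
  apply: (@le_trans _ _ (`|L| * mdist x y)).
    by rewrite ler_wpM2r ?mdist_ge0// ler_norm.
  apply: (@le_trans _ _ (`|L| * (4 * M ^+ 2 * mdist (emb x) (emb y)))).
    by rewrite ler_wpM2l.
  by rewrite mulrA ler_wpM2r// lerDr.
exists C => z1 z2.
have [z1S|z1N] := boolP (sph_extend phi z1 != 0).
  by case: z1 z1S => [x|] /=; rewrite ?eqxx//; exact: H.
have [z2S|z2N] := boolP (sph_extend phi z2 != 0).
  rewrite distrC metric_sym.
  by case: z2 z2S => [x|] /=; rewrite ?eqxx//; exact: H.
move: z1N z2N; rewrite !negbK => /eqP -> /eqP ->.
by rewrite subrr normr0 mulr_ge0 ?mdist_ge0// addr_ge0.
Qed.

Lemma energy_le_sph E v (phi : S -> R) : open E ->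
  test_function (sph_set a E) phi ->
  energy_le muhat p (sph_set a E) v phi <->
  energy_le mu p E (v \o emb) (phi \o emb).
Proof.
move=> oE tphi; have phi0 := test_function_sph_infty tphi.
have [_ _ supp] := tphi; have [[L phiL] _ _] := test_function_emb tphi.
set A := [set x | phi (emb x) != 0].
have AE : A `<=` E.
  move=> x Ax; apply/(sph_set_emb a); apply: supp; exact: subset_closure.
(* [energy_sph] is stated for open sets. The radius below keeps [phi] from reaching 0, and the added
   1 avoids division by 0. *)
have oA : open A.
  rewrite openE => x Ax; apply/nbhs_ballP.
  have x0 : 0 < `|phi (emb x)| by rewrite normr_gt0.
  have L1 : 0 < `|L| + 1 by rewrite ltr_wpDl.
  exists (`|phi (emb x)| / (`|L| + 1)); first by rewrite /= divr_gt0.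
  move=> y; rewrite ballEmdist/= ltr_pdivlMr// => xy; apply/negP => /eqP y0.
  have := phiL x y; rewrite /= y0 subr0 => h.
  have : L * mdist x y <= (`|L| + 1) * mdist x y.
    by rewrite ler_wpM2r ?mdist_ge0//; have := ler_norm L; lra.
  by move=> ?; lra.
rewrite /energy_le (sph_support phi0) -/A.
by rewrite !energy_sph.
Qed.

Lemma minimizer_sph E v : open E ->
  minimizer muhat p (sph_set a E) v <-> minimizer mu p E (v \o emb).
Proof.
move=> oE; split=> -[/(newtonian_loc_sph _ oE) Nv H]; split => // phi tphi.
  apply/(@energy_le_sph _ v (sph_extend phi)) => //; first exact: test_function_extend.
  by apply: H; exact: test_function_extend.
by apply/energy_le_sph => //; apply: H; exact: test_function_emb.
Qed.

Lemma superminimizer_sph E v : open E ->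
  superminimizer muhat p (sph_set a E) v <-> superminimizer mu p E (v \o emb).
Proof.
move=> oE; split=> -[/(newtonian_loc_sph _ oE) Nv H]; split => // phi tphi phi0.
  apply/(@energy_le_sph _ v (sph_extend phi)) => //; first exact: test_function_extend.
  by apply: H; [exact: test_function_extend|case].
apply/energy_le_sph => //; apply: H => [|x]; last exact: phi0.
exact: test_function_emb.
Qed.

Lemma pharmonic_sph E (u : X -> \bar R) : open E ->
  pharmonic mu p E u <-> pharmonic muhat p (sph_set a E) (sph_fun a u).
Proof.
move=> oE; split=> -[cu mu_u]; split.
- exact/continuous_within_sph.
- exact/minimizer_sph.
- exact/(@continuous_within_sph _ _ _ a _ _ (sph_fun a u)).
- exact/(@minimizer_sph _ (sph_fun a u)).
Qed.

End sph_potential_theory.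

(** * Superharmonic functions *)

Lemma ess_inf_onS (R : realType) (d : measure_display) (T : borelMetricType d R)
    (mu : {measure set T -> \bar R}) (A B : set T) (u : T -> \bar R) :
  A `<=` B -> (ess_inf_on mu B u <= ess_inf_on mu A u)%E.
Proof.
move=> AB; apply: ereal_sup_le => y /=; apply: filterS => x H /AB.
exact: H.
Qed.

(** Both functions are nonincreasing in the radius, so their limits at 0 are suprema, and mutual
    domination makes these equal. *)
Lemma interleaved_cvg_at_right (R : realType) (F G : R -> \bar R) (l : \bar R) :
  (forall r s, 0 < r -> r <= s -> (F s <= F r)%E) ->
  (forall r s, 0 < r -> r <= s -> (G s <= G r)%E) ->
  (forall r, 0 < r -> exists2 s, 0 < s & (F r <= G s)%E) ->
  (forall r, 0 < r -> exists2 s, 0 < s & (G r <= F s)%E) ->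
  F r @[r --> 0^'+] --> l -> G r @[r --> 0^'+] --> l.
Proof.
move=> Fdec Gdec FG GF Fl.
pose sup (H : R -> \bar R) := ereal_sup [set H r | r in `]0, +oo[%classic].
have cvg_sup (H : R -> \bar R) : (forall r s, 0 < r -> r <= s -> (H s <= H r)%E) ->
    H r @[r --> 0^'+] --> sup H.
  move=> Hdec; apply: (@nonincreasing_at_right_cvge _ _ _ +oo%O) => //.
  by move=> r s; rewrite !in_itv/= !andbT => r0 _ rs; exact: Hdec.
have <- : sup G = l.
  rewrite -(cvg_unique _ (cvg_sup F Fdec) Fl)//; apply/eqP; rewrite eq_le.
  apply/andP; split; apply: ge_ereal_sup => _ [r /= + <-]; rewrite in_itv/= andbT => r0.
    have [s s0 /le_trans] := GF r r0; apply; apply: ereal_sup_ubound.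
    by exists s; rewrite //= in_itv/= s0.
  have [s s0 /le_trans] := FG r r0; apply; apply: ereal_sup_ubound.
  by exists s; rewrite //= in_itv/= s0.
exact: cvg_sup.
Qed.

Section sph_superharmonic.
Context (R : realType) (d : measure_display) (X : borelMetricType d R) (a : X).
Variables (mu : {measure set X -> \bar R}) (p : R).
Hypothesis p_gt0 : 0 < p.
Local Notation S := (sphericalization a).
Local Notation emb := (Some : X -> S).
Let muhat : {measure set S -> \bar R} := sph_measure a p mu.
Implicit Types (x y : X) (z : S) (E : set X) (v : S -> \bar R).

Lemma ess_inf_on_sph (B : set S) v :
  ess_inf_on muhat B v = ess_inf_on mu (emb @^-1` B) (v \o emb).
Proof.
congr ereal_sup; apply/funext => y; apply/propext.
exact: (@ae_sph _ _ _ _ _ _ (fun z => B z -> (y <= v z)%E)).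
Qed.

(** Balls about x for the two metrics are nested in each other, by dhat <= d and [sph_mdist_small],
    and the two measures have the same null sets. *)
Lemma ess_inf_cvg_sph (x : X) v (l : \bar R) :
  ess_inf_on muhat (ball (emb x) r) v @[r --> 0^'+] --> l <->
  ess_inf_on mu (ball x r) (v \o emb) @[r --> 0^'+] --> l.
Proof.
have ball_emb (r : R) : ball x r `<=` emb @^-1` (ball (emb x) r).
  by move=> y /=; rewrite !ballEmdist/=; exact/le_lt_trans/sph_mdist_le_mdist.
have dec r s : 0 < r -> r <= s ->
    (ess_inf_on mu (ball x s) (v \o emb) <= ess_inf_on mu (ball x r) (v \o emb))%E.
  by move=> _ rs; apply: ess_inf_onS; exact: le_ball.
have dec' r s : 0 < r -> r <= s ->
    (ess_inf_on muhat (ball (emb x) s) v <= ess_inf_on muhat (ball (emb x) r) v)%E.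
  by move=> _ rs; apply: ess_inf_onS; exact: le_ball.
have le1 r : 0 < r -> exists2 s, 0 < s &
    (ess_inf_on muhat (ball (emb x) r) v <= ess_inf_on mu (ball x s) (v \o emb))%E.
  by move=> r0; exists r => //; rewrite ess_inf_on_sph; exact: ess_inf_onS.
have le2 r : 0 < r -> exists2 s, 0 < s &
    (ess_inf_on mu (ball x r) (v \o emb) <= ess_inf_on muhat (ball (emb x) s) v)%E.
  move=> r0; have [s s0 H] := sph_mdist_small a x r0; exists s => //.
  rewrite ess_inf_on_sph; apply: ess_inf_onS => y /=.
  by rewrite !ballEmdist/= => /H[_ [<-]].
by split; exact: interleaved_cvg_at_right.
Qed.

Lemma superharmonic_sph E (u : X -> \bar R) : open E ->
  superharmonic mu p E u <-> superharmonic muhat p (sph_set a E) (sph_fun a u).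
Proof.
move=> oE; split=> -[u_gt comp lim smin]; split.
- by move=> _ [x Ex <-]; exact: u_gt.
- move=> _ [x Ex <-]; have [y Exy uy] := comp x Ex.
  by exists (emb y) => //; exact/connected_component_sph.
- move=> _ [x Ex <-].
  exact/(@ess_inf_cvg_sph x (sph_fun a u))/lim.
- by move=> k; apply/superminimizer_sph => //; exact: smin.
- by move=> x Ex; apply: (u_gt (emb x)); exists x.
- move=> x Ex; have [[y|] Exy uy] := comp (emb x) (imageP _ Ex).
    by exists y => //; exact/(connected_component_sph a).
  by have [] := connected_component_sub Exy.
- move=> x Ex; apply/(@ess_inf_cvg_sph x (sph_fun a u)); apply: lim.
  by exists x.
- move=> k.
  exact: (superminimizer_sph mu p_gt0 (fun z => mine (sph_fun a u z) (k%:~R)%:E) oE).1 (smin k).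
Qed.

End sph_superharmonic.

Unset Implicit Arguments.

Theorem theorem6p3 (R : realType) (d : measure_display)
    (X : borelMetricType d R) (mu : {measure set X -> \bar R})
    (p q Q : R) (a : X) (Omega : set X)
    (mu_complete : measure_is_complete mu)
    (mu_balls : finite_pos_on_balls mu)
    (X_complete : complete_space X)
    (X_unbounded : unbounded_space X)
    (Q_gt1 : 1 < Q)
    (mu_regular : ahlfors_regular mu Q)
    (p_range_small : Q < 2 -> 1 < p < Q / (2 - Q))
    (p_range_large : 2 <= Q -> Q / 2 < p)
    (q_def_small : Q / 2 < p <= Q -> q = p)
    (q_def_large : Q <= p -> q = p * Q / (2 * p - Q))
    (X_poincare : poincare_inequality mu q)
    (Omega_open : open Omega)
    (Omega_nonempty : Omega !=set0) :
  let muhat : {measure set (sphericalization a) -> \bar R} :=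
    sph_measure a p mu in
  let Omegahat : set (sphericalization a) := sph_set a Omega in
  [/\ forall u : X -> R,
        minimizer mu p Omega (fun x => (u x)%:E) <->
        minimizer muhat p Omegahat (sph_fun a (fun x => (u x)%:E)),
      forall u : X -> R,
        superminimizer mu p Omega (fun x => (u x)%:E) <->
        superminimizer muhat p Omegahat (sph_fun a (fun x => (u x)%:E)),
      forall u : X -> \bar R,
        pharmonic mu p Omega u <->
        pharmonic muhat p Omegahat (sph_fun a u) &
      forall u : X -> \bar R,
        superharmonic mu p Omega u <->
        superharmonic muhat p Omegahat (sph_fun a u)].
Proof.
move=> muhat Omegahat.
have p_gt0 : 0 < p.
  have [/p_range_small/andP[p1 _]|/[dup] Q2 /p_range_large Qp] := ltP Q 2; lra.
split=> u.
- exact: iff_sym (minimizer_sph mu p_gt0 (sph_fun a (EFin \o u)) Omega_open).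
- exact: iff_sym (superminimizer_sph mu p_gt0 (sph_fun a (EFin \o u)) Omega_open).
- exact: pharmonic_sph.
- exact: superharmonic_sph.
Qed.
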